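(* Let $G$ be a Cayley graph of a group $\Gamma$ and let $H$ be an infinite subgroup of $\Gamma$. For each $p\in[0,1]$, there is a unique $H$-infinite cluster in $G_p$ almost surely if and only if $\inf_{x,y\in H}\tau_p(x,y)>0$.
   Context: Cayley graphs are taken with respect to finite generating sets (so they are connected and locally finite, with vertex set $\Gamma$). $G_p$ denotes Bernoulli bond percolation on $G$: each edge is independently retained (open) with probability $p$ and deleted otherwise, with law $\mathbb{P}_p$; connected components of $G_p$ are called clusters. For a set $A$ of vertices, a cluster $K$ is called $A$-infinite if $|K\cap A|=\infty$. The two-point function is $\tau_p(x,y)=\mathbb{P}_p(x\text{ and }y\text{ belong to the same cluster})$. *)

(* Defs.v *)
From mathcomp Require Import all_boot all_order all_algebra.
From mathcomp Require Import finmap.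
From mathcomp Require Import all_classical all_reals all_analysis.
From Stdlib Require Import Relation_Operators.

Set Implicit Arguments.
Unset Strict Implicit.
Unset Printing Implicit Defensive.

Import Order.TTheory GRing.Theory Num.Theory.
Local Open Scope classical_set_scope.
Local Open Scope ring_scope.

Definition is_subgroup (Gamma : groupType) (H : set Gamma) : Prop :=
  group_closed [in H].

Definition generates (Gamma : groupType) (S : set Gamma) : Prop :=
  smallest (@is_subgroup Gamma) S = [set: Gamma].

(* The Cayley graph is simple: [S] is symmetrized, and the loops that
   [1 \in S] would give are dropped. Gamma acts on it by left translation. *)
Definition cayley_adj (Gamma : groupType) (S : set Gamma) (x y : Gamma) : Prop :=
  x <> y /\ (S (x^-1 * y)%g \/ S (y^-1 * x)%g).

Definition cayley_edges (Gamma : groupType) (S : set Gamma) : set (set Gamma) :=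
  [set e | exists x y : Gamma, cayley_adj S x y /\ e = [set x; y]].

(* {0,1}^E with the product sigma-algebra; [true] means open. *)
Definition cylinders (Gamma : groupType) (S : set Gamma) :
    set (set (cayley_edges S -> bool)) :=
  [set C | exists (e : cayley_edges S) (b : bool), C = [set w | w e = b]].
Arguments cylinders {Gamma} S.

Definition config (Gamma : groupType) (S : set Gamma) :=
  g_sigma_algebraType (cylinders S).

(* The cylinder formula determines [P] uniquely, by the pi-lambda theorem: it is
   the product over the edges of the Bernoulli(p) laws. *)
Definition bernoulli_percolation (R : realType) (Gamma : groupType)
    (S : set Gamma) (p : R) (P : probability (config S) R) : Prop :=
  forall (A : {fset cayley_edges S}) (b : cayley_edges S -> bool),
    P [set w | forall e, e \in A -> w e = b e] =
    (\prod_(e <- A) bernoulli_pmf p (b e))%:E.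

Section open_clusters.
Variables (Gamma : groupType) (S : set Gamma) (w : config S).

Definition open_adj (x y : Gamma) : Prop :=
  exists e : cayley_edges S, val e = [set x; y] /\ w e = true.

Definition open_cluster (x : Gamma) : set Gamma :=
  [set y | clos_refl_trans Gamma open_adj x y].

Definition open_clusters : set (set Gamma) := range open_cluster.

End open_clusters.

Definition infinite_along (Gamma : groupType) (A K : set Gamma) : Prop :=
  infinite_set (K `&` A).

(* The event is measurable since Gamma is countable when [S] is finite and
   generates. *)
Definition two_point (R : realType) (Gamma : groupType) (S : set Gamma)
    (P : probability (config S) R) (x y : Gamma) : \bar R :=
  P [set w | exists K, [/\ open_clusters w K, K x & K y]].

(* Main.v *)
Require Import Defs.
From mathcomp Require Import all_boot all_order all_algebra finmap.
From mathcomp Require Import all_classical all_reals all_analysis.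
From mathcomp Require Import ring lra zify.
From Stdlib Require Import Relation_Operators.

Set Implicit Arguments.
Unset Strict Implicit.
Unset Printing Implicit Defensive.

Import Order.TTheory GRing.Theory Num.Theory numFieldNormedType.Exports.
Local Open Scope classical_set_scope.
Local Open Scope ring_scope.

(** Write K_x for the cluster of x, tau for the two-point function, and 1 for the
    unit of the group.

    If the H-infinite cluster is almost surely unique, then the probability theta
    that 1 lies in an H-infinite cluster is positive, and two points of H which both
    lie in H-infinite clusters are connected. Translates of an event by far elements
    are asymptotically independent of it (mixing), so tau(1, h) is at least
    theta^2 / 2 outside a finite set of h; on this set, opening paths gives a
    positive lower bound (unique_two_point_bound).

    Conversely let tau be at least delta > 0 on H. The point 1 is connected to
    infinitely many points of H with probability at least delta, so by ergodicity
    under H (zero_one) an H-infinite cluster exists almost surely.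

    For its uniqueness, call energy of a finitely supported probability measure c on
    H the expected sum of the squares of the masses that c gives to the clusters;
    this is the quadratic form of tau. It is at least delta. A sequence b of measures whose energies tend to
    the infimum is nearly invariant, by the parallelogram identity: almost surely
    every cluster has a density, the limit of its b(n)-masses, and translating b(n)
    by an element of H does not change this limit (clusters_have_density). Density
    is additive over disjoint clusters, so merging two clusters of positive density,
    one of which has nearly the maximal density, would exceed this maximum, which is
    almost surely constant: there is exactly one cluster of positive density, the
    heavy cluster (heavy_unique, heavy_ae).

    It remains to exclude a light, that is zero-density, H-infinite cluster. Opening
    edges along a path would bring it next to the heavy cluster, and opening one more
    edge e would produce a site: an open bridge from a light H-infinite branch to a
    heavy stem. Consider all sites that are translates of this one by H. As a heavy
    stem is not contained in a light branch, the branches are nested or disjoint,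
    and the sites around a point form a chain with a smallest element. Mass
    transport (mass_transport_finite, mass_transport_balanced) shows that every
    branch contains a site right below it, because otherwise infinitely many points
    would choose the same smallest site, and then that each site has exactly one
    child and one parent. Hence the sites of a cluster form a bi-infinite chain
    (sites_form_chains). The chain is ordered from its light end to its heavy end,
    but b(n) may be chosen symmetric, and this forbids such an order: as n
    grows, a b(n)-step from 1 is ever less likely to end in the smallest branch around
    1, which is light; by symmetry it is as unlikely to end at a point whose smallest
    branch contains 1; but these two cases exhaust the cluster of 1, which has
    positive density (covered_negligible). *)

(** * Events and their probabilities *)

Section events.
Context {d : measure_display} {T : measurableType d}.
Implicit Types A B : T -> Prop.

Lemma measurable_conj A B : measurable [set w | A w] -> measurable [set w | B w] ->
  measurable [set w | A w /\ B w].
Proof. exact: measurableI. Qed.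

Lemma measurable_disj A B : measurable [set w | A w] -> measurable [set w | B w] ->
  measurable [set w | A w \/ B w].
Proof. exact: measurableU. Qed.

Lemma measurable_compl A : measurable [set w | A w] -> measurable [set w | ~ A w].
Proof. exact: measurableC. Qed.

Lemma measurable_imply A B :
  measurable [set w | A w] -> measurable [set w | B w] ->
  measurable [set w | A w -> B w].
Proof.
move=> mA mB.
have -> : [set w | A w -> B w] = [set w | ~ A w \/ B w].
  by apply: eq_set => w; rewrite implyE.
by apply: measurable_disj => //; apply: measurable_compl.
Qed.

Lemma measurable_prop (Q : Prop) : measurable [set _ : T | Q].
Proof.
have [q|nq] := pselect Q.
  by have -> : [set _ : T | Q] = setT by apply/seteqP; split.
by have -> : [set _ : T | Q] = set0 by apply/seteqP; split.
Qed.

Lemma measurable_ex (U : Type) (F : U -> T -> Prop) : countable [set: U] ->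
  (forall i, measurable [set w | F i w]) -> measurable [set w | exists i, F i w].
Proof.
move=> cU mF.
have -> : [set w | exists i, F i w] = \bigcup_i [set w | F i w].
  by apply/seteqP; split => w /= [i]; [move=> ?; exists i|move=> _ ?; exists i].
exact: countable_bigcupT_measurable.
Qed.

Lemma measurable_all (U : Type) (F : U -> T -> Prop) : countable [set: U] ->
  (forall i, measurable [set w | F i w]) -> measurable [set w | forall i, F i w].
Proof.
move=> cU mF.
have -> : [set w | forall i, F i w] = [set w | ~ exists i, ~ F i w].
  apply/seteqP; split => w /=; first by move=> h [i]; exact.
  by move=> h i; apply: contrapT => hi; apply: h; exists i.
by apply/measurable_compl/measurable_ex => // i; exact: measurable_compl.
Qed.

End events.

Section probability_of_events.
Context {d : measure_display} {T : measurableType d} {R : realType}.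
Variable P : probability T R.
Implicit Types A B : set T.

Definition Prob A : R := fine (P A).
Local Notation Pr := Prob.

Lemma PrE A : measurable A -> P A = (Pr A)%:E.
Proof. by move=> mA; rewrite fineK// fin_num_measure. Qed.

Lemma Pr_ge0 A : 0 <= Pr A.
Proof. exact: fine_ge0. Qed.

Lemma le_Pr A B : measurable A -> measurable B -> A `<=` B -> Pr A <= Pr B.
Proof. by move=> mA mB AB; rewrite -lee_fin -!PrE// le_measure// inE. Qed.

Lemma Pr_le1 A : measurable A -> Pr A <= 1.
Proof. by move=> mA; rewrite -lee_fin -PrE// probability_le1. Qed.

Lemma Pr_setT : Pr setT = 1.
Proof. by rewrite /Prob probability_setT. Qed.

Lemma Pr_set0 : Pr set0 = 0.
Proof. by rewrite /Prob measure0. Qed.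

Lemma PrU_disj A B : measurable A -> measurable B -> A `&` B = set0 ->
  Pr (A `|` B) = Pr A + Pr B.
Proof.
move=> mA mB AB; apply: EFin_inj; rewrite EFinD -!PrE//; last exact: measurableU.
exact: measureU.
Qed.

Lemma Pr_split A B : measurable A -> measurable B ->
  Pr A = Pr (A `&` B) + Pr (A `&` ~` B).
Proof.
move=> mA mB; rewrite -PrU_disj ?setIUr.
- by rewrite -setIUr setUv setIT.
- exact: measurableI.
- by apply: measurableI => //; exact: measurableC.
- by rewrite setIACA setICr setI0.
Qed.

Lemma PrC A : measurable A -> Pr (~` A) = 1 - Pr A.
Proof.
move=> mA; have := Pr_split (@measurableT _ T) mA; rewrite !setTI Pr_setT => ->.
by rewrite addrC addKr.
Qed.

Lemma PrU_le A B : measurable A -> measurable B -> Pr (A `|` B) <= Pr A + Pr B.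
Proof.
move=> mA mB; rewrite (Pr_split (measurableU _ _ mA mB) mA).
have -> : (A `|` B) `&` A = A by rewrite setIC setUC setKU.
rewrite lerD2l; apply: le_Pr => //.
  by apply: measurableI; [exact: measurableU|exact: measurableC].
by move=> w [[]].
Qed.

Lemma negligibleE A : measurable A -> P.-negligible A <-> Pr A = 0.
Proof.
move=> mA; split.
  by move=> /(negligibleP P mA) PA; rewrite /Prob PA.
by move=> A0; apply/(negligibleP P mA); rewrite [LHS]PrE// A0.
Qed.

Lemma Pr_gt0E A : measurable A -> ~ P.-negligible A -> 0 < Pr A.
Proof.
move=> mA nA; rewrite lt_neqAle Pr_ge0 andbT eq_sym; apply/eqP => A0.
exact/nA/negligibleE.
Qed.

Lemma negligible_exists (U : Type) (F : U -> T -> Prop) : countable [set: U] ->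
  (forall i, P.-negligible [set w | F i w]) ->
  P.-negligible [set w | exists i, F i w].
Proof.
move=> /pfcard_geP[U0|[f]] nF.
  apply: (negligibleS _ (negligible_set0 P)) => w /= [i _].
  by have : [set: U] i by []; rewrite U0.
apply: (negligibleS _ (negligible_bigcup (fun k => nF (f k)))) => w /= [i Fi].
by have [n _ fn] := @surj _ _ _ _ f i I; exists n => //; rewrite fn.
Qed.

(** Positivity of the expectation, for finite combinations of indicators: all
    moment estimates below are instances, and no integral remains in them. *)
Lemma Pr_comb_ge0 (I : Type) (s : seq I) (r : I -> R) (A : I -> T -> Prop) :
  (forall i, measurable [set w | A i w]) ->
  (forall w, 0 <= \sum_(i <- s) r i * (`[< A i w >])%:R) ->
  0 <= \sum_(i <- s) r i * Pr [set w | A i w].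
Proof.
move=> mA s0; pose f (s : seq I) (w : T) : R := \sum_(i <- s) r i * (`[< A i w >])%:R.
suff [_ /(congr1 fine) /= <-] : P.-integrable setT (EFin \o f s) /\
    (\int[P]_w (f s w)%:E)%E = (\sum_(i <- s) r i * Pr [set w | A i w])%:E.
  by apply: fine_ge0; apply: integral_ge0 => w _; rewrite lee_fin s0.
elim: s {s0} => [|i s [is_ IHs]].
  rewrite big_nil; under eq_integral do rewrite /f big_nil.
  split; last by rewrite integral0.
  by apply: eq_integrable (integrable0 _ _) => // w _; rewrite /f /= big_nil.
have fE w : (f (i :: s) w)%:E =
    ((r i)%:E * (\1_[set w | A i w] w)%:E + (EFin \o f s) w)%E.
  by rewrite /f big_cons.
have iA : P.-integrable setT (fun w => (r i)%:E * (\1_[set w | A i w] w)%:E)%E.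
  by apply: integrableZl => //; exact: integrable_indic.
split.
  by apply: eq_integrable (integrableD _ iA is_) => // w _; rewrite /= -fE.
under eq_integral do rewrite fE.
rewrite integralD// IHs integralZl//; last exact: integrable_indic.
by rewrite integral_indic// setIT big_cons EFinD EFinM -PrE.
Qed.

(** Reverse Fatou for events. It replaces limits of expectations: a lower bound
    on all the probabilities yields a configuration in infinitely many of the
    events. *)
Lemma Pr_io_ge (F : (set T)^nat) (e : R) : (forall n, measurable (F n)) ->
  (forall n, e <= Pr (F n)) -> e <= Pr [set w | forall N, exists n, (N <= n)%N /\ F n w].
Proof.
move=> mF eF.
pose G N := [set w | exists n, (N <= n)%N /\ F n w].
have mG N : measurable (G N).
  apply: measurable_ex => // n; apply: measurable_conj; last exact: mF.
  exact: measurable_prop.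
rewrite [X in Pr X](_ : _ = \bigcap_N G N); last first.
  by apply/seteqP; split=> w; rewrite /bigcap /= => h k; [move=> _|]; exact: h.
have mGc : measurable (\bigcap_N G N) by exact: bigcapT_measurable.
rewrite -lee_fin -PrE//.
have homoG : {homo G : n m / (n <= m)%N >-> (m <= n)%O}.
  move=> n m nm; rewrite subsetEset => w [k [mk Fk]].
  by exists k; split => //; exact: leq_trans mk.
have cv : (P \o G) x @[x --> \oo] --> P (\bigcap_n G n).
  apply: nonincreasing_cvg_mu => //.
  by rewrite (le_lt_trans (probability_le1 P _)) ?ltry.
rewrite -(cvg_lim _ cv)//; apply: lime_ge; first by apply/cvg_ex; eexists; exact: cv.
apply: nearW => n /=; rewrite PrE// lee_fin (le_trans (eF n))//.
by apply: le_Pr => // w Fw; exists n.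
Qed.

End probability_of_events.

(** * Cayley graphs *)

Section cayley_graphs.
Variables (Gamma : groupType) (S : set Gamma).
Implicit Types (x y z h : Gamma).

Lemma subgroup1 (H : set Gamma) : is_subgroup H -> H 1%g.
Proof. by move=> [H1 _]; rewrite inE in H1. Qed.

Lemma subgroup_div (H : set Gamma) x y : is_subgroup H -> H x -> H y -> H (x / y)%g.
Proof. by move=> [_ Hd] Hx Hy; have := Hd x y; rewrite !inE; exact. Qed.

Lemma subgroupV (H : set Gamma) x : is_subgroup H -> H x -> H x^-1%g.
Proof. by move=> sH Hx; rewrite -[x^-1%g]mul1g; apply: subgroup_div => //; exact: subgroup1. Qed.

Lemma subgroupM (H : set Gamma) x y : is_subgroup H -> H x -> H y -> H (x * y)%g.
Proof. by move=> sH Hx Hy; rewrite -[y]invgK; apply: subgroup_div => //; exact: subgroupV. Qed.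

Lemma mk_subgroup (H : set Gamma) : H 1%g -> (forall x y, H x -> H y -> H (x * y)%g) ->
  (forall x, H x -> H x^-1%g) -> is_subgroup H.
Proof.
move=> H1 HM HV; split; first by rewrite inE.
by move=> x y; rewrite !inE => Hx Hy; apply: HM => //; exact: HV.
Qed.

Lemma generates_ind (Q : set Gamma) : generates S -> is_subgroup Q -> S `<=` Q ->
  forall x, Q x.
Proof.
move=> gS sQ SQ x; have : [set: Gamma] x by [].
by rewrite -gS; apply; split.
Qed.

Lemma countable_generated : finite_set S -> generates S -> countable [set: Gamma].
Proof.
move=> /finite_seqP[s sE] gS.
pose f (l : seq (nat * bool)) : Gamma :=
  foldr (fun ib g => (if ib.2 then nth 1%g s ib.1 else (nth 1%g s ib.1)^-1) * g)%g 1%g l.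
have f_cat l l' : f (l ++ l') = (f l * f l')%g.
  by elim: l => [|a l IHl] /=; rewrite ?mul1g// IHl mulgA.
have f_ex g : exists l, f l = g.
  apply: (@generates_ind [set g | exists l, f l = g]) => //=; last first.
    move=> x; rewrite sE /= => xs; exists [:: (index x s, true)].
    by rewrite /f /= mulg1 nth_index.
  apply: mk_subgroup => /=; first by exists [::].
    by move=> _ _ [l <-] [l' <-]; exists (l ++ l').
  move=> _ [l <-]; elim: l => [|[i b] l [l' IHl]]; first by exists [::]; rewrite /= invg1.
  exists (l' ++ [:: (i, ~~ b)]); rewrite f_cat IHl /= mulg1 invgM.
  by case: b => //=; rewrite invgK.
have -> : [set: Gamma] = range f.
  by apply/esym/seteqP; split => // g _; have [l] := f_ex g; exists l.
exact: (sub_countable (card_image_le _ _)).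
Qed.

Lemma cayley_adj_sym x y : cayley_adj S x y -> cayley_adj S y x.
Proof. by move=> [xy Sxy]; split; [exact/nesym|case: Sxy; [right|left]]. Qed.

Lemma cayley_adjM h x y : cayley_adj S x y -> cayley_adj S (h * x)%g (h * y)%g.
Proof.
have E a b : ((h * a)^-1 * (h * b) = a^-1 * b)%g by rewrite invgM -mulgA mulKg.
by move=> [xy Sxy]; split; [move/mulgI|rewrite !E].
Qed.

(** Connectedness of the graph as an induction principle. The group elements g
    such that right multiplication by g preserves all properties that are closed
    under adjacency form a subgroup containing S. *)
Lemma cayley_ind (Q : Gamma -> Prop) x0 : generates S -> Q x0 ->
  (forall x y, cayley_adj S x y -> Q x -> Q y) -> forall x, Q x.
Proof.
move=> gS Qx0 Qadj x.
pose Z := [set g | forall Q : Gamma -> Prop,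
  (forall x y, cayley_adj S x y -> Q x -> Q y) -> forall z, Q z <-> Q (z * g)%g].
have sZ : is_subgroup Z.
  apply: mk_subgroup => /=.
  - by move=> Q' _ z; rewrite mulg1.
  - by move=> g g' Zg Zg' Q' HQ z; rewrite (Zg Q')// (Zg' Q')// mulgA.
  - by move=> g Zg Q' HQ z; rewrite [X in _ <-> X](Zg Q')// mulgVK.
have SZ : S `<=` Z.
  move=> g Sg Q' HQ z.
  have [->|g1] := pselect (g = 1%g); first by rewrite mulg1.
  have adj : cayley_adj S z (z * g)%g.
    split; last by left; rewrite mulKg.
    by rewrite -{1}[z]mulg1 => /mulgI /esym.
  by split; apply: HQ => //; exact: cayley_adj_sym.
have := generates_ind gS sZ SZ (x0^-1 * x)%g => /(_ Q Qadj x0).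
by rewrite mulVKg => -[+ _]; exact.
Qed.

Local Notation edge := (cayley_edges S).

Lemma translate_edge h (e : set Gamma) : cayley_edges S e ->
  cayley_edges S [set (h * x)%g | x in e].
Proof.
move=> [x [y [xy ->]]]; exists (h * x)%g, (h * y)%g; split; first exact: cayley_adjM.
by rewrite image_setU !image_set1.
Qed.

Definition mul_edge h (e : edge) : edge :=
  SigSub (mem_set (translate_edge h (set_valP e))).

Lemma val_mul_edge h e : val (mul_edge h e) = [set (h * x)%g | x in val e].
Proof. by []. Qed.

Lemma mul_edgeA h g e : mul_edge h (mul_edge g e) = mul_edge (h * g)%g e.
Proof.
apply: val_inj; rewrite !val_mul_edge image_comp.
by apply: eq_imagel => x _ /=; rewrite mulgA.
Qed.

Lemma mul_edge1 e : mul_edge 1%g e = e.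
Proof.
apply: val_inj; rewrite val_mul_edge -[RHS]image_id.
by apply: eq_imagel => x _ /=; rewrite mul1g.
Qed.

Lemma mul_edgeK h : cancel (mul_edge h) (mul_edge h^-1%g).
Proof. by move=> e; rewrite mul_edgeA mulVg mul_edge1. Qed.

Lemma mul_edgeKV h : cancel (mul_edge h^-1%g) (mul_edge h).
Proof. by move=> e; rewrite mul_edgeA mulgV mul_edge1. Qed.

Lemma mk_edge x y : cayley_adj S x y -> exists e : edge, val e = [set x; y].
Proof.
move=> xy; have exy : cayley_edges S [set x; y] by exists x, y.
by exists (SigSub (mem_set exy)).
Qed.

Lemma edge_ends (e : edge) : exists x y, cayley_adj S x y /\ val e = [set x; y].
Proof. by have [x [y [xy ->]]] := set_valP e; exists x, y. Qed.

Lemma set2_inj (x y a b : Gamma) : [set x; y] = [set a; b] -> (x = a /\ y = b) \/ (x = b /\ y = a).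
Proof.
move=> E.
have xab : [set a; b] x by rewrite -E; left.
have yab : [set a; b] y by rewrite -E; right.
have axy : [set x; y] a by rewrite E; left.
have bxy : [set x; y] b by rewrite E; right.
case: xab => /= xE; [left|right]; split => //.
  by case: bxy => /= bE; case: yab => /= yE; congruence.
by case: axy => /= aE; case: yab => /= yE; congruence.
Qed.

(** The action on vertices is free, so a group element is known from the image of
    one end of an edge, which is one of two points. *)
Lemma finite_edge_mover (e f : edge) : exists s : seq Gamma, forall h, mul_edge h e = f -> h \in s.
Proof.
have [x [y [_ ex]]] := edge_ends e; have [a [b [_ fa]]] := edge_ends f.
exists [:: a / x; b / x]%g => h /(congr1 val); rewrite val_mul_edge ex fa image_setU !image_set1.
by move=> /set2_inj[[<- _]|[<- _]]; rewrite mulgK !inE eqxx ?orbT.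
Qed.

End cayley_graphs.

(** * Configurations *)

Section configurations.
Variables (Gamma : groupType) (S : set Gamma).
Local Notation edge := (cayley_edges S).
Local Notation config := (config S).
Implicit Types (w : config) (e f : edge) (b : bool) (h : Gamma).

Definition update e b w : config := fun f => if f == e then b else w f.

Definition translate h w : config := fun e => w (mul_edge h^-1%g e).

Definition cylinder (l : seq (edge * bool)) : set config :=
  [set w | forall x, x \in l -> w x.1 = x.2].

Lemma measurable_edge e b : measurable [set w : config | w e = b].
Proof. by apply: sub_sigma_algebra; exists e, b. Qed.

Lemma measurable_config_map (phi : config -> config) :
  (forall e b, measurable [set w | phi w e = b]) -> measurable_fun setT phi.
Proof.
move=> mphi; refine (@measurability _ _ config config setT phi (cylinders S) _ _) => //.
by move=> _ [_ [e [b ->]] <-]; rewrite setTI; exact: mphi.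
Qed.

Lemma measurable_update e b : measurable_fun setT (update e b).
Proof.
apply: measurable_config_map => f b'; rewrite /update.
by case: eqP => _; [exact: measurable_prop|exact: measurable_edge].
Qed.

Lemma measurable_translate h : measurable_fun setT (translate h).
Proof. by apply: measurable_config_map => e b; exact: measurable_edge. Qed.

Lemma measurable_pre (phi : config -> config) (A : config -> Prop) :
  measurable_fun setT phi -> measurable [set w | A w] -> measurable [set w | A (phi w)].
Proof. by move=> mphi mA; have := mphi measurableT _ mA; rewrite setTI. Qed.

Lemma cylinder_cons x l : cylinder (x :: l) = [set w | w x.1 = x.2] `&` cylinder l.
Proof.
apply/seteqP; split => w /=.
  move=> wxl; split; first by apply: wxl; rewrite mem_head.
  by move=> y yl; apply: wxl; rewrite in_cons yl orbT.
by move=> [wx wl] y; rewrite in_cons => /orP[/eqP ->//|]; exact: wl.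
Qed.

Lemma cylinder_cat l l' : cylinder (l ++ l') = cylinder l `&` cylinder l'.
Proof.
elim: l => [|x l IHl] /=; last by rewrite !cylinder_cons IHl setIA.
suff -> : cylinder [::] = setT by rewrite setTI.
by apply/seteqP; split.
Qed.

Lemma measurable_cylinder l : measurable (cylinder l).
Proof.
elim: l => [|x l IHl]; last first.
  by rewrite cylinder_cons; apply: measurableI => //; exact: measurable_edge.
suff -> : cylinder [::] = setT by [].
by apply/seteqP; split.
Qed.

Lemma updateE e b w : update e b w e = b.
Proof. by rewrite /update eqxx. Qed.

Lemma update_id e b w : w e = b -> update e b w = w.
Proof. by move=> web; apply/funext => f; rewrite /update; case: eqP => [->|]. Qed.

Lemma update_update e b b' w : update e b (update e b' w) = update e b w.
Proof. by apply/funext => f; rewrite /update; case: eqP. Qed.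

Lemma translate_update h e b w :
  translate h (update e b w) = update (mul_edge h e) b (translate h w).
Proof.
apply/funext => f; rewrite /translate /update.
by rewrite -(can2_eq (mul_edgeKV h) (mul_edgeK h)).
Qed.

Lemma translateM h g w : translate h (translate g w) = translate (h * g)%g w.
Proof. by apply/funext => e; rewrite /translate mul_edgeA invgM. Qed.

Lemma translate1 w : translate 1%g w = w.
Proof. by apply/funext => e; rewrite /translate invg1 mul_edge1. Qed.

Lemma translateK h : cancel (translate h) (translate h^-1%g).
Proof. by move=> w; rewrite translateM mulVg translate1. Qed.

Lemma translateKV h : cancel (translate h^-1%g) (translate h).
Proof. by move=> w; rewrite translateM mulgV translate1. Qed.

Variables (R : realType) (p : R) (p_01 : 0 <= p <= 1).
Variable P : probability config R.
Hypothesis P_p : bernoulli_percolation p P.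
Local Notation Pr := (Prob P).

(** Cylinders are stable under intersection; lists may repeat or contradict
    themselves, which keeps this true without side conditions. *)
Lemma measure_config_unique (m1 m2 : {measure set config -> \bar R}) :
  (m1 setT < +oo)%E ->
  (forall l, m1 (cylinder l) = m2 (cylinder l)) ->
  forall A, measurable A -> m1 A = m2 A.
Proof.
move=> m1oo m12 A mA.
apply: (@g_sigma_algebra_measure_unique _ _ _ (range cylinder) _ (fun=> setT)) => //.
- by move=> _ [l _ <-]; exact: measurable_cylinder.
- by move=> _; exists [::] => //; apply/seteqP; split.
- by rewrite bigcup_const.
- by move=> _ _ [l _ <-] [l' _ <-]; exists (l ++ l') => //; rewrite cylinder_cat.
- by move=> _ [l _ <-].
- apply: mA; split; first exact: smallest_sigma_algebra.
  move=> _ [e [b ->]]; apply: sub_sigma_algebra; exists [:: (e, b)] => //.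
  rewrite cylinder_cons; apply/seteqP; split => w //=; first by case.
Qed.

Lemma Pr_cylinder (l : seq (edge * bool)) w : cylinder l w ->
  Pr (cylinder l) = \prod_(e <- [fset x.1 | x in l]%fset) bernoulli_pmf p (w e).
Proof.
move=> wl; apply: EFin_inj; rewrite -PrE; last exact: measurable_cylinder.
rewrite -P_p; congr (P _); apply/seteqP; split => w' /= w'l.
  by move=> e /imfsetP[x /= xl ->]; rewrite (w'l _ xl) (wl _ xl).
move=> x xl; rewrite w'l; first exact: wl.
by apply/imfsetP; exists x.
Qed.

Lemma Pr_edge_indep_cylinder e b (l : seq (edge * bool)) : e \notin map fst l ->
  Pr (cylinder ((e, b) :: l)) = bernoulli_pmf p b * Pr (cylinder l).
Proof.
move=> el; have [[w wl]|nl] := pselect (exists w, cylinder l w); last first.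
  have l0 : cylinder l = set0 by apply/seteqP; split => // w wl; case: nl; exists w.
  by rewrite cylinder_cons l0 setI0 Pr_set0 mulr0.
have wl' : cylinder ((e, b) :: l) (update e b w).
  rewrite cylinder_cons; split => /=; first exact: updateE.
  move=> x xl; rewrite /update; case: eqP => [xe|_]; last exact: wl.
  by move: el; rewrite -xe map_f.
rewrite (Pr_cylinder wl') (Pr_cylinder wl).
have -> : [fset x.1 | x in (e, b) :: l]%fset = (e |` [fset x.1 | x in l])%fset.
  apply/fsetP => f; rewrite in_fset1U; apply/imfsetP/orP => /=.
    move=> [x]; rewrite in_cons => /orP[/eqP -> ->|xl ->]; first by left.
    by right; apply/imfsetP; exists x.
  move=> [/eqP ->|/imfsetP[x /= xl ->]]; first by exists (e, b); rewrite ?mem_head.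
  by exists x => //; rewrite in_cons xl orbT.
have eF : e \notin [fset x.1 | x in l]%fset.
  by apply/negP => /imfsetP[x /= xl exl]; move: el; rewrite exl map_f.
rewrite big_fsetU1//= updateE; congr (_ * _).
rewrite big_seq [RHS]big_seq; apply: eq_bigr => f fl.
by rewrite /update; case: eqP => // fe; move: eF; rewrite -fe fl.
Qed.


(** Both sides are finite measures as functions of A, and they agree on cylinders,
    where the product formula splits off the factor of e. *)
Lemma Pr_update e b (A : config -> Prop) : measurable [set w | A w] ->
  bernoulli_pmf p b * Pr [set w | A (update e b w)] =
  Pr [set w | w e = b /\ A w].
Proof.
move=> mA.
have q0 : 0 <= bernoulli_pmf p b.
  by case/andP: p_01 => p0 p1; rewrite /bernoulli_pmf; case: b; rewrite ?subr_ge0.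
pose q := NngNum q0.
have mE := measurable_edge e b.
have mup := @measurable_update e b.
pose mu1 : {measure set config -> \bar R} := mscale q (pushforward P (update e b)).
pose mu2 : {measure set config -> \bar R} := mrestr P mE.
have mAup : measurable [set w | A (update e b w)] by exact: measurable_pre.
have mAE : measurable [set w : config | w e = b /\ A w] by exact: (measurable_conj mE mA).
suff h : mu1 mup [set w | A w] = mu2 [set w | A w].
  apply: EFin_inj; rewrite EFinM -!PrE//.
  have -> : [set w : config | w e = b /\ A w] = [set w | A w] `&` [set w | w e = b].
    by rewrite setIC.
  exact: h.
apply: measure_config_unique => //.
  change (q%:num%:E * P setT < +oo)%E.
  by rewrite probability_setT mule1 ltry.
move=> l; rewrite /mu1 /mu2 /mscale /mrestr /pushforward /=.
have mU : measurable (update e b @^-1` cylinder l).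
  by have := mup measurableT _ (measurable_cylinder l); rewrite setTI.
change (q%:num%:E * P (update e b @^-1` cylinder l) =
  P (cylinder l `&` [set w | w e = b]))%E.
rewrite (PrE P mU) PrE; last by apply: measurableI => //; exact: measurable_cylinder.
rewrite -EFinM; congr (_%:E).
have [[b' [ebl bb']]|nb] := pselect (exists b', (e, b') \in l /\ b' <> b).
  have -> : update e b @^-1` cylinder l = set0.
    by apply/seteqP; split => // w /(_ _ ebl) /=; rewrite updateE => /esym.
  have -> : cylinder l `&` [set w | w e = b] = set0.
    by apply/seteqP; split => // w [/(_ _ ebl) /= -> /bb'].
  by rewrite Pr_set0 mulr0.
pose l' := [seq x <- l | x.1 != e].
have -> : update e b @^-1` cylinder l = cylinder l'.
  apply/seteqP; split => w wl x.
    rewrite mem_filter => /andP[/negPf xe xl].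
    by have := wl _ xl; rewrite /update xe.
  move=> xl; rewrite /update; case: eqP => [xe|/eqP xe]; last first.
    by apply: wl; rewrite mem_filter xe.
  apply: contrapT => bx; apply: nb; exists x.2; split; last exact/nesym.
  by rewrite -xe; case: x xl {xe bx}.
have -> : cylinder l `&` [set w | w e = b] = cylinder ((e, b) :: l').
  rewrite cylinder_cons setIC /=; apply/seteqP; split => w /= [web wl]; split => //.
    by move=> x; rewrite mem_filter => /andP[_]; exact: wl.
  move=> x xl; have [xe|xe] := eqVneq x.1 e; last by apply: wl; rewrite mem_filter xe.
  rewrite xe web; apply: contrapT => bx; apply: nb; exists x.2; split; last exact/nesym.
  by rewrite -xe; case: x xl {xe bx}.
rewrite Pr_edge_indep_cylinder//; apply/negP => /mapP[x]; rewrite mem_filter.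
by move=> /andP[/eqP + _] => + ex; rewrite ex.
Qed.

Lemma Pr_translate h (A : config -> Prop) : measurable [set w | A w] ->
  Pr [set w | A (translate h w)] = Pr [set w | A w].
Proof.
move=> mA; have mt := @measurable_translate h.
pose mu1 : {measure set config -> \bar R} := pushforward P (translate h).
congr fine.
change (mu1 mt [set w | A w] = P [set w | A w]).
apply: measure_config_unique => //.
  change (P setT < +oo)%E.
  by rewrite probability_setT ltry.
move=> l; rewrite /mu1 /pushforward /=.
have mT : measurable (translate h @^-1` cylinder l).
  by have := mt measurableT _ (measurable_cylinder l); rewrite setTI.
change (P (translate h @^-1` cylinder l) = P (cylinder l)).
rewrite (PrE P mT) (PrE P (measurable_cylinder l)); congr (_%:E).
pose l' := [seq (mul_edge h^-1%g x.1, x.2) | x <- l].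
have lE : translate h @^-1` cylinder l = cylinder l'.
  apply/seteqP; split => w wl x; first by move=> /mapP[y yl ->]; exact: (wl y).
  by move=> xl; have := wl (mul_edge h^-1%g x.1, x.2); apply; apply/mapP; exists x.
rewrite lE; have [[w wl]|nl] := pselect (exists w, cylinder l w); last first.
  have -> : cylinder l = set0 by apply/seteqP; split => // w wl; case: nl; exists w.
  suff -> : cylinder l' = set0 by [].
  apply/seteqP; split => // w; rewrite -lE => wl; case: nl.
  by exists (translate h w).
have wl' : cylinder l' (translate h^-1%g w).
  by rewrite -lE /preimage /= translateKV.
rewrite (Pr_cylinder wl') (Pr_cylinder wl).
have -> : [fset x.1 | x in l']%fset =
    [fset mul_edge h^-1%g e | e in [fset x.1 | x in l]]%fset.
  apply/fsetP => f; apply/imfsetP/imfsetP => /=.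
    move=> [_ /mapP[x xl ->] ->]; exists x.1 => //=.
    by apply/imfsetP; exists x.
  move=> [_ /imfsetP[x /= xl ->] ->]; exists (mul_edge h^-1%g x.1, x.2) => //.
  by apply/mapP; exists x.
rewrite big_imfset /=; last by move=> e f _ _; exact: (can_inj (mul_edgeKV h)).
by apply: eq_bigr => e _; rewrite /translate invgK mul_edgeKV.
Qed.

(** Insertion tolerance: a null event stays null when e is forced to be open,
    because this costs a factor p only. *)
Lemma negligible_update e (A : set config) : 0 < p ->
  P.-negligible A -> P.-negligible [set w | A (update e true w)].
Proof.
move=> p0 [N [mN N0 AN]].
have mup : measurable [set w | N (update e true w)].
  by apply: measurable_pre => //; exact: measurable_update.
apply: (@negligibleS _ _ _ _ [set w | N (update e true w)]); first by move=> w /= /AN.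
apply/(negligibleE P mup).
have := @Pr_update e true _ mN; rewrite /bernoulli_pmf.
have -> : Pr [set w | w e = true /\ N w] = 0.
  apply/eqP; rewrite eq_le Pr_ge0 andbT.
  have <- : Pr N = 0 by rewrite /Prob N0.
  by apply: le_Pr => //; [apply: measurable_conj => //; exact: measurable_edge|move=> w []].
by move/eqP; rewrite mulf_eq0 => /orP[/eqP p00|/eqP//]; rewrite p00 ltxx in p0.
Qed.

Lemma negligible_translate h (A : set config) :
  P.-negligible A -> P.-negligible [set w | A (translate h w)].
Proof.
move=> [N [mN N0 AN]].
have mt : measurable [set w | N (translate h w)].
  by apply: measurable_pre => //; exact: measurable_translate.
apply: (@negligibleS _ _ _ _ [set w | N (translate h w)]); first by move=> w /= /AN.
by apply/(negligibleE P mt); rewrite Pr_translate// /Prob N0.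
Qed.

(** * Finitely determined events *)

Definition determined_by (F : seq edge) (A : config -> Prop) :=
  forall w w', {in F, w =1 w'} -> A w -> A w'.

Lemma determined_indep (F : seq edge) (A B : config -> Prop) :
  measurable [set w | A w] -> measurable [set w | B w] -> determined_by F A ->
  (forall e b w, e \in F -> B (update e b w) <-> B w) ->
  Pr [set w | A w /\ B w] = Pr [set w | A w] * Pr [set w | B w].
Proof.
elim: F A => [|e F IHF] A mA mB dA BF.
  have [[w0 A0]|nA] := pselect (exists w, A w).
    have AT w : A w by apply: dA A0.
    have -> : [set w | A w /\ B w] = [set w | B w].
      by apply/seteqP; split => w // [].
    have -> : [set w : config | A w] = setT.
      by apply/seteqP; split => // w _; exact: AT.
    by rewrite Pr_setT mul1r.
  have -> : [set w | A w /\ B w] = set0.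
    by apply/seteqP; split => // w [Aw _]; apply: nA; exists w.
  have -> : [set w | A w] = set0.
    by apply/seteqP; split => // w Aw; apply: nA; exists w.
  by rewrite Pr_set0 mul0r.
have mE b := @measurable_edge e b.
have split_e C : measurable [set w : config | C w] -> Pr [set w | C w] =
    \sum_(b : bool) bernoulli_pmf p b * Pr [set w | C (update e b w)].
  move=> mC; rewrite (Pr_split P mC (mE true)) big_bool /=; congr (_ + _).
    by rewrite (Pr_update e true mC) setIC.
  rewrite (Pr_update e false mC); congr (Pr _); apply/seteqP; split => w /=.
    by move=> [Cw]; case: (w e).
  by move=> [we Cw]; rewrite we.
have mpre b C : measurable [set w : config | C w] -> measurable [set w | C (update e b w)].
  by move=> mC; apply: measurable_pre => //; exact: measurable_update.
rewrite split_e; last exact: measurable_conj.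
rewrite (split_e A)// mulr_suml; apply: eq_bigr => b _; rewrite -mulrA; congr (_ * _).
rewrite -IHF //.
- congr (Pr _); apply/seteqP; split => w /=; rewrite BF// mem_head//.
- exact: mpre.
- move=> w w' ww'; apply: dA => f; rewrite in_cons /update.
  by case: (eqVneq f e) => //= _ fF; exact: ww'.
- by move=> f b' w fF; apply: BF; rewrite in_cons fF orbT.
Qed.

Definition symm_diff (A B : config -> Prop) w := ~ (A w <-> B w).

Lemma measurable_symm_diff (A B : config -> Prop) : measurable [set w | A w] ->
  measurable [set w | B w] -> measurable [set w | symm_diff A B w].
Proof.
move=> mA mB; apply: measurable_compl.
by apply: measurable_conj; apply: measurable_imply.
Qed.

Lemma Pr_symm_diff (A B : config -> Prop) : measurable [set w | A w] ->
  measurable [set w | B w] ->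
  `|Pr [set w | A w] - Pr [set w | B w]| <= Pr [set w | symm_diff A B w].
Proof.
have h (C D : config -> Prop) : measurable [set w | C w] -> measurable [set w | D w] ->
    Pr [set w | C w] <= Pr [set w | D w] + Pr [set w | symm_diff C D w].
  move=> mC mD; have mCD := measurable_symm_diff mC mD.
  apply: le_trans (PrU_le P mD mCD); apply: le_Pr => //; first exact: measurableU.
  move=> w Cw; have [Dw|nDw] := pselect (D w); first by left.
  by right => /= -[/(_ Cw)].
move=> mA mB; rewrite ler_norml.
have := h _ _ mA mB; have := h _ _ mB mA.
have -> : [set w | symm_diff B A w] = [set w | symm_diff A B w].
  by apply: eq_set => w; rewrite /symm_diff; apply/propext; split => + [? ?]; apply.
by move=> *; apply/andP; split; lra.
Qed.

(** Finitely determined events are dense: the events that they approximate form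
    a sigma-algebra. *)
Lemma approximate (A : config -> Prop) (eps : R) : measurable [set w | A w] -> 0 < eps ->
  exists F (B : config -> Prop), [/\ measurable [set w | B w], determined_by F B &
    Pr [set w | symm_diff A B w] <= eps].
Proof.
pose approx := [set A : set config | measurable A /\ forall eps : R, 0 < eps ->
  exists F (B : config -> Prop), [/\ measurable [set w | B w], determined_by F B &
    Pr [set w | symm_diff A B w] <= eps]].
move=> mA eps0; suff [_] : approx [set w | A w] by exact.
have symm0 (C : config -> Prop) : [set w | symm_diff C C w] = set0.
  by apply/seteqP; split => // w; apply.
apply: mA; split; last first.
  move=> _ [e [b ->]]; split; first exact: measurable_edge.
  move=> r r0; exists [:: e], (fun w => w e = b); split.
  - exact: measurable_edge.
  - by move=> w w' ww' <-; rewrite ww'// mem_head.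
  - by rewrite symm0 Pr_set0 ltW.
split.
- split => // r r0; exists [::], (fun=> False); split => //.
  + exact: measurable_prop.
  + by rewrite symm0 Pr_set0 ltW.
- move=> C [mC aC]; rewrite setTD; split; first exact: measurableC.
  move=> r /aC[F [B [mB dB CB]]]; exists F, (fun w => ~ B w); split.
  + exact: measurable_compl.
  + move=> w w' ww' nBw Bw'; apply: nBw; apply: dB Bw' => e eF.
    by rewrite ww'.
  + suff -> : [set w | symm_diff (~` C) (fun w => ~ B w) w] = [set w | symm_diff C B w] by [].
    have not_iffE (X Y : Prop) : (~ X <-> ~ Y) <-> (X <-> Y).
      split => [nXY|->//]; split => h; apply: contrapT => nh.
        exact: (nXY.2 nh h).
      exact: (nXY.1 nh h).
    by apply: eq_set => w; apply/propext; split; apply: contra_not => /not_iffE.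
- move=> C0 aC; pose C : (set config)^nat := C0; have {}aC : forall n, approx (C n) := aC.
  change (approx (\bigcup_k C k)).
  have mC n : measurable (C n) by have [] := aC n.
  split; first exact: bigcupT_measurable.
  move=> r r0; have r2 : 0 < r / 2 by rewrite divr_gt0.
  have mU := bigcupT_measurable C mC.
  pose D n := \bigcup_(k in [set k | (k < n)%N]) C k.
  have mD n : measurable (D n) by exact: bigcup_measurable.
  have DU : \bigcup_n D n = \bigcup_n C n.
    apply/seteqP; split => w [n _].
      by move=> [k _ Cw]; exists k.
    by move=> Cw; exists n.+1 => //; exists n => /=.
  have cv : (P \o D) x @[x --> \oo] --> P (\bigcup_n C n).
    rewrite -DU; apply: nondecreasing_cvg_mu => //; first by rewrite DU.
    move=> n m nm; rewrite subsetEset => w [k kn Ck]; exists k => //=.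
    exact: leq_trans nm.
  have [n Dn] : exists n, Pr (\bigcup_n C n) - r / 2 < Pr (D n).
    move: cv; rewrite (PrE P mU) => /fine_cvgP[_ cv].
    have /cvgrPdist_lt /(_ _ r2) [N _ /(_ N (leqnn N))] := cv.
    by rewrite ltr_norml => /andP[_ /= h]; exists N; rewrite /Prob in h *; lra.
  have [F [B [mB dB DB]]] : exists F (B : config -> Prop),
      [/\ measurable [set w | B w], determined_by F B &
        Pr [set w | symm_diff (D n) B w] <= r / 2].
    have : forall r : R, 0 < r -> exists F (B : config -> Prop),
      [/\ measurable [set w | B w], determined_by F B &
        Pr [set w | symm_diff (D n) B w] <= r]; last exact.
    elim: n {Dn} => [|n IHn] s s0.
      have -> : D 0%N = set0 by apply/seteqP; split => // w [].
      exists [::], (fun=> False); split => //; first exact: measurable_prop.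
      by rewrite symm0 Pr_set0 ltW.
    have s2 : 0 < s / 2 by rewrite divr_gt0.
    have [F [B [mB dB DB]]] := IHn _ s2.
    have [_ /(_ _ s2)[F' [B' [mB' dB' CB']]]] := aC n.
    exists (F ++ F'), (fun w => B w \/ B' w); split; first exact: measurable_disj.
      move=> w w' ww' [Bw|Bw']; [left; apply: dB Bw|right; apply: dB' Bw'].
        by move=> e eF; apply: ww'; rewrite mem_cat eF.
      by move=> e eF; apply: ww'; rewrite mem_cat eF orbT.
    have m1 := measurable_symm_diff (mD n) mB.
    have m2 := measurable_symm_diff (mC n) mB'.
    apply: (@le_trans _ _ (s / 2 + s / 2)); last by lra.
    apply: le_trans (lerD DB CB'); apply: le_trans (PrU_le P m1 m2).
    apply: le_Pr; first by apply: measurable_symm_diff; [exact: mD|exact: measurable_disj].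
      exact: measurableU.
    have DS w : D n.+1 w <-> D n w \/ C n w.
      split => [[k /= + Ck]|[[k /= kn Ck]|Cn]].
      - by rewrite ltnS leq_eqVlt => /orP[/eqP <-|kn]; [right|left; exists k].
      - by exists k => //=; exact: ltn_trans kn _.
      - by exists n => /=.
    move=> w /= nDB; apply: contrapT => /not_orP[/contrapT h1 /contrapT h2].
    apply: nDB; split; first by move=> /DS[/h1|/h2] ?; [left|right].
    by move=> [/h1 ?|/h2 ?]; apply/DS; [left|right].
  exists F, B; split => //.
  have m1 : measurable (\bigcup_n C n `&` ~` D n).
    by apply: measurableI => //; exact: measurableC.
  have m2 := measurable_symm_diff (mD n) mB.
  apply: (@le_trans _ _ (r / 2 + r / 2)); last by lra.
  apply: (@le_trans _ _ (Pr (\bigcup_n C n `&` ~` D n) + Pr [set w | symm_diff (D n) B w])).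
    apply: le_trans (PrU_le P m1 m2); apply: le_Pr.
    - exact: measurable_symm_diff.
    - exact: measurableU.
    move=> w /= nCB; have [Dw|nDw] := pselect (D n w).
      right => DBw; apply: nCB; split; first by move=> _; exact/DBw.
      by move=> _; have [k _ Ck] := Dw; exists k.
    have [Cw|nCw] := pselect ((\bigcup_n C n) w); first by left.
    by right => DBw; apply: nCB; split => // /DBw.
  apply: lerD => //.
  have := Pr_split P mU (mD n).
  have -> : \bigcup_n C n `&` D n = D n.
    by apply: setIidr => w [k _ Ck]; exists k.
  by lra.
Qed.

End configurations.

(** * Connectivity *)

Section connectivity.
Variables (Gamma : groupType) (S : set Gamma).
Local Notation edge := (cayley_edges S).
Local Notation config := (config S).
Implicit Types (w : config) (e f : edge) (b : bool) (x y z h : Gamma).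

Definition linked w x y := open_cluster w x y.

Lemma linked_refl w x : linked w x x.
Proof. exact: rt_refl. Qed.

Lemma linked_trans w x y z : linked w x y -> linked w y z -> linked w x z.
Proof. exact: rt_trans. Qed.

Lemma open_adj_sym w x y : open_adj w x y -> open_adj w y x.
Proof. by move=> [e [ve we]]; exists e; rewrite setUC. Qed.

Lemma linked_sym w x y : linked w x y -> linked w y x.
Proof.
elim=> [a c /open_adj_sym ?|a|a c d _ ca _ dc]; [exact: rt_step|exact: rt_refl|].
exact: linked_trans ca.
Qed.

Lemma linked_adj w x y : open_adj w x y -> linked w x y.
Proof. exact: rt_step. Qed.

Lemma linked_mono w w' x y : (forall e, w e = true -> w' e = true) ->
  linked w x y -> linked w' x y.
Proof.
move=> ww'; elim=> [a c [e [ve we]]|a|a c d _ ac _ cd].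
- by apply: linked_adj; exists e; split => //; exact: ww'.
- exact: linked_refl.
- exact: linked_trans cd.
Qed.

Lemma linked_set w (A : set Gamma) x y :
  (forall a c, A a -> open_adj w a c -> A c) -> A x -> linked w x y -> A y.
Proof. by move=> clA + xy; elim: xy => // [a c ac Aa|a c d _ IH1 _ IH2 /IH1/IH2//]; exact: clA ac. Qed.

Lemma linked_open w e x y : linked w x y -> linked (update e true w) x y.
Proof. by apply: linked_mono => f wf; rewrite /update; case: eqP. Qed.

Lemma linked_close w e x y : linked (update e false w) x y -> linked w x y.
Proof. by apply: linked_mono => f; rewrite /update; case: eqP. Qed.

Lemma open_adj_translate h w x y :
  open_adj (translate h w) (h * x)%g (h * y)%g <-> open_adj w x y.
Proof.
suff imp g w' a c : open_adj w' a c -> open_adj (translate g w') (g * a)%g (g * c)%g.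
  split; last exact: imp.
  by move=> /(imp h^-1%g); rewrite translateK !mulKg.
move=> [e [ve we]]; exists (mul_edge g e); rewrite /translate mul_edgeK; split => //.
by rewrite val_mul_edge ve image_setU !image_set1.
Qed.

Lemma linked_translate h w x y :
  linked (translate h w) (h * x)%g (h * y)%g <-> linked w x y.
Proof.
suff imp g w' a c : linked w' a c -> linked (translate g w') (g * a)%g (g * c)%g.
  split; last exact: imp.
  by move=> /(imp h^-1%g); rewrite translateK !mulKg.
elim=> [u v uv|u|u v t _ uv _ vt].
- by apply: linked_adj; apply/open_adj_translate.
- exact: linked_refl.
- exact: linked_trans vt.
Qed.

Lemma open_clustersP w x y :
  (exists K, [/\ open_clusters w K, K x & K y]) <-> linked w x y.
Proof.
split => [[_ [[z _ <-] zx zy]]|xy].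
  exact: linked_trans (linked_sym zx) zy.
by exists (open_cluster w x); split => //; [exists x|exact: linked_refl].
Qed.

Lemma open_cluster_eq w x y : linked w x y -> open_cluster w x = open_cluster w y.
Proof.
move=> xy; apply/seteqP; split => z; first exact: linked_trans (linked_sym xy).
exact: linked_trans xy.
Qed.

Hypothesis cG : countable [set: Gamma].

Lemma measurable_open_adj x y : measurable [set w : config | open_adj w x y].
Proof.
have [[e ve]|ne] := pselect (exists e : edge, val e = [set x; y]).
  have -> : [set w : config | open_adj w x y] = [set w | w e = true].
    apply/seteqP; split => w /=; last by exists e.
    by move=> [f [vf wf]]; have -> : e = f by apply: val_inj; rewrite ve.
  exact: measurable_edge.
have -> : [set w : config | open_adj w x y] = [set w | False].
  by apply/seteqP; split => w //= [f [vf wf]]; apply: ne; exists f.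
exact: measurable_prop.
Qed.

Fixpoint reach w (n : nat) x y : Prop :=
  if n is m.+1 then exists z, reach w m x z /\ open_adj w z y else x = y.

Lemma linkedP w x y : linked w x y <-> exists n, reach w n x y.
Proof.
split => [xy|[n]].
  elim: (Operators_Properties.clos_rt_rtn1 _ _ _ _ xy) => [|a c ac _ [n xa]]; first by exists 0.
  by exists n.+1, a.
elim: n y => [_ <-|n IHn y [z [/IHn xz zy]]]; first exact: linked_refl.
by apply: linked_trans xz _; exact: linked_adj.
Qed.

Lemma measurable_linked x y : measurable [set w : config | linked w x y].
Proof.
have -> : [set w : config | linked w x y] = [set w | exists n, reach w n x y].
  by apply: eq_set => w; apply/propext; exact: linkedP.
apply: measurable_ex => // n; elim: n y => [|n IHn] y /=; first exact: measurable_prop.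
apply: measurable_ex => // z; apply: measurable_conj; first exact: IHn.
exact: measurable_open_adj.
Qed.

End connectivity.

(** * Mixing and ergodicity *)

Section mixing.
Variables (Gamma : groupType) (S : set Gamma).
Local Notation edge := (cayley_edges S).
Local Notation config := (config S).
Variables (R : realType) (p : R) (p_01 : 0 <= p <= 1).
Variable P : probability config R.
Hypothesis P_p : bernoulli_percolation p P.
Local Notation Pr := (Prob P).

Lemma finite_edges_mover (F F' : seq edge) : exists s : seq Gamma,
  forall h e, e \in F -> mul_edge h e \in F' -> h \in s.
Proof.
elim: F => [|e F [s IHs]]; first by exists [::].
have [s' s'P] : exists s : seq Gamma, forall h, mul_edge h e \in F' -> h \in s.
  elim: F' {s IHs} => [|f F' [s IHs]]; first by exists [::].
  have [s' s'P] := finite_edge_mover e f.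
  exists (s' ++ s) => h; rewrite in_cons mem_cat => /orP[/eqP/s'P ->//|/IHs ->].
  by rewrite orbT.
exists (s' ++ s) => h f; rewrite in_cons mem_cat => /orP[/eqP ->/s'P ->//|fF fF'].
by rewrite (IHs _ _ fF fF') orbT.
Qed.

(** Far translates of an event are asymptotically independent of any other:
    approximate both by finitely determined events. *)
Lemma mixing (A B : config -> Prop) (eps : R) : measurable [set w | A w] ->
  measurable [set w | B w] -> 0 < eps -> exists s : seq Gamma, forall h, h \notin s ->
  `|Pr [set w | A w /\ B (translate h w)] - Pr [set w | A w] * Pr [set w | B w]| <= eps.
Proof.
move=> mA mB eps0; have e4 : 0 < eps / 4 by rewrite divr_gt0.
have [F [A' [mA' dA' AA']]] := approximate P mA e4.
have [F' [B' [mB' dB' BB']]] := approximate P mB e4.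
have [s sP] := finite_edges_mover F F'; exists s => h hs.
have mt (C : config -> Prop) : measurable [set w | C w] ->
    measurable [set w | C (translate h w)].
  by apply: measurable_pre; exact: measurable_translate.
have mBh := mt _ mB; have mBh' := mt _ mB'.
have indep : Pr [set w | A' w /\ B' (translate h w)] =
    Pr [set w | A' w] * Pr [set w | B' w].
  rewrite (determined_indep p_01 P_p mA' mBh' dA'); last first.
    move=> e b w eF; rewrite translate_update.
    suff upd w' b' : B' w' -> B' (update (mul_edge h e) b' w').
      split; last exact: upd.
      by move=> /(upd _ ((translate h w) (mul_edge h e))); rewrite update_update update_id.
    apply: dB' => f fF'; rewrite /update; case: eqP => // fe.
    by move: hs; rewrite (sP _ e)// -fe.
  by rewrite (Pr_translate P_p).
have mAB := measurable_conj mA mBh; have mAB' := measurable_conj mA' mBh'.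
have mdA := measurable_symm_diff mA mA'; have mdB := measurable_symm_diff mB mB'.
have mdBh := mt _ mdB.
have h1 := Pr_symm_diff P mAB mAB'.
have h2 : Pr [set w | symm_diff (fun w => A w /\ B (translate h w))
    (fun w => A' w /\ B' (translate h w)) w] <= eps / 4 + eps / 4.
  apply: le_trans (lerD AA' BB'); rewrite -(Pr_translate P_p h mdB).
  apply: le_trans (PrU_le P mdA mdBh); apply: le_Pr; first exact: measurable_symm_diff.
    exact: measurableU.
  move=> w /= nAB; apply: contrapT => /not_orP[/contrapT dA /contrapT dB].
  by apply: nAB; rewrite dA dB.
have h3 := le_trans (Pr_symm_diff P mA mA') AA'.
have h4 := le_trans (Pr_symm_diff P mB mB') BB'.
have ? := Pr_ge0 P [set w | A w]; have ? := Pr_ge0 P [set w | B w].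
have ? := Pr_le1 P mA; have ? := Pr_le1 P mB'.
have h5 : `|Pr [set w | A' w] * Pr [set w | B' w] - Pr [set w | A w] * Pr [set w | B w]|
    <= eps / 4 + eps / 4.
  have -> : Pr [set w | A' w] * Pr [set w | B' w] - Pr [set w | A w] * Pr [set w | B w] =
     (Pr [set w | A' w] - Pr [set w | A w]) * Pr [set w | B' w] +
     Pr [set w | A w] * (Pr [set w | B' w] - Pr [set w | B w]) by ring.
  apply: le_trans (ler_normD _ _) _; rewrite !normrM; apply: lerD.
    rewrite -[leRHS]mulr1; apply: ler_pM => //; first by rewrite distrC.
    by rewrite ger0_norm// Pr_ge0.
  rewrite -[leRHS]mul1r; apply: ler_pM => //; last by rewrite distrC.
  by rewrite ger0_norm.
rewrite indep in h1.
have := ler_distD (Pr [set w | A' w] * Pr [set w | B' w])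
  (Pr [set w | A w /\ B (translate h w)]) (Pr [set w | A w] * Pr [set w | B w]).
by move: h1 h2 h5; lra.
Qed.

(** Mixing at infinity makes the action of an infinite subgroup ergodic. *)
Lemma zero_one (H : set Gamma) (A : config -> Prop) : infinite_set H ->
  measurable [set w | A w] -> (forall h w, H h -> A (translate h w) <-> A w) ->
  Pr [set w | A w] = 0 \/ Pr [set w | A w] = 1.
Proof.
move=> H_inf mA invA; set a := Pr [set w | A w].
suff : `|a - a * a| = 0.
  move=> /normr0_eq0 /eqP; rewrite -{1}[a]mulr1 -mulrBr mulf_eq0 => /orP[/eqP|]; first by left.
  by rewrite subr_eq0 => /eqP <-; right.
apply/eqP; rewrite eq_le normr_ge0 andbT; apply/ler_addgt0Pr => eps eps0; rewrite add0r.
have [s sP] := mixing mA mA eps0.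
have [h [Hh hs]] : exists h, H h /\ h \notin s.
  apply: contrapT => nh; apply: H_inf; apply: (sub_finite_set _ (finite_seq s)) => h Hh /=.
  by apply: contrapT => /negP hs; apply: nh; exists h.
have := sP h hs; congr (`|Pr _ - _| <= _); apply/seteqP; split => w /=; first by case.
by move=> Aw; split => //; exact/(invA h w Hh).
Qed.

End mixing.

(** * Clusters that are infinite along a subgroup *)

Section infinite_clusters.
Variables (Gamma : groupType) (S : set Gamma).
Local Notation edge := (cayley_edges S).
Local Notation config := (config S).
Implicit Types (w : config) (e f : edge) (b : bool) (x y z h : Gamma) (A : set Gamma).

Definition translate_set h A : set Gamma := [set (h * y)%g | y in A].

Lemma translate_setP h A y : translate_set h A y <-> A (h^-1 * y)%g.
Proof.
split => [[z Az <-]|Ay]; first by rewrite mulKg.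
by exists (h^-1 * y)%g => //; rewrite mulVKg.
Qed.

Lemma translate_setK h A : translate_set h^-1%g (translate_set h A) = A.
Proof. by apply/seteqP; split => y; rewrite !translate_setP invgK mulKg. Qed.

Lemma open_cluster_translate h w x :
  open_cluster (translate h w) (h * x)%g = translate_set h (open_cluster w x).
Proof.
apply/seteqP; split => y.
  move=> hxy; apply/translate_setP; apply/(linked_translate h).
  by rewrite mulVKg.
by move/translate_setP => xy; rewrite -[y](mulVKg h); apply/linked_translate.
Qed.

Variables (H : set Gamma) (sH : is_subgroup H).

Lemma subgroup_mulE h x : H h -> H (h * x)%g <-> H x.
Proof.
move=> Hh; split; last exact: subgroupM.
by move=> Hhx; rewrite -(mulKg h x); apply: subgroupM => //; exact: subgroupV.
Qed.

Lemma infinite_along_translate h A : H h ->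
  infinite_along H (translate_set h A) <-> infinite_along H A.
Proof.
suff imp g B : H g -> infinite_along H B -> infinite_along H (translate_set g B).
  move=> Hh; split; last exact: imp.
  by move=> /(imp h^-1%g); rewrite translate_setK; apply; exact: subgroupV.
move=> Hg; apply: contra_not => fin.
have -> : B `&` H = (fun y => g^-1 * y)%g @` (translate_set g B `&` H); last exact: finite_image.
apply/seteqP; split => y.
  move=> [By Hy]; exists (g * y)%g; last by rewrite mulKg.
  by split; [exists y|exact: subgroupM].
by move=> [_ [[z Bz <-] Hgz] <-]; rewrite mulKg; split => //; exact/(subgroup_mulE _ Hg).
Qed.

Lemma infinite_alongS A B : A `<=` B -> infinite_along H A -> infinite_along H B.
Proof. by move=> AB; apply: contra_not; apply: sub_finite_set; apply: setSI. Qed.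

Hypothesis cG : countable [set: Gamma].

Lemma infinite_alongP : exists f : Gamma -> nat, forall A,
  infinite_along H A <-> forall n, exists y, [/\ A y, H y & (n <= f y)%N].
Proof.
have /countable_injP[f finj] := cG; exists f => A; split.
  move=> Ainf n; apply: contrapT => nA; apply: Ainf.
  have sub : A `&` H `<=` f @^-1` `I_n.
    by move=> y [Ay Hy] /=; rewrite ltnNge; apply/negP => ny; apply: nA; exists y.
  apply: sub_finite_set sub _; apply: finite_preimage; last exact: finite_II.
  by move=> y z _ _; apply: finj; rewrite inE.
move=> An /finite_seqP[s sE].
have [y [Ay Hy]] := An (\max_(y <- s) f y).+1.
have : y \in s by have : [set` s] y by rewrite -sE.
by move=> ys; rewrite ltnNge (leq_bigmax_seq _ ys).
Qed.

Lemma measurable_infinite_along (K : config -> set Gamma) :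
  (forall y, measurable [set w | K w y]) -> measurable [set w | infinite_along H (K w)].
Proof.
move=> mK; have [f fP] := infinite_alongP.
have -> : [set w | infinite_along H (K w)] =
    [set w | forall n, exists y, K w y /\ (H y /\ (n <= f y)%N)].
  apply: eq_set => w; apply/propext; rewrite fP; split => h n; have [y] := h n.
    by move=> [? ? ?]; exists y.
  by move=> [? [? ?]]; exists y.
apply: measurable_all => // n; apply: measurable_ex => // y.
by apply: measurable_conj => //; exact: measurable_prop.
Qed.

Variables (R : realType) (p : R) (p_01 : 0 <= p <= 1).
Variable P : probability config R.
Hypothesis P_p : bernoulli_percolation p P.
Local Notation Pr := (Prob P).
Hypothesis gS : generates S.

Definition tau x y : R := Pr [set w | linked w x y].

Lemma two_pointE x y : two_point P x y = (tau x y)%:E.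
Proof.
rewrite /two_point -PrE; last exact: measurable_linked.
by congr (P _); apply: eq_set => w; apply/propext; exact: open_clustersP.
Qed.

Lemma tau_mul h x y : tau (h * x)%g (h * y)%g = tau x y.
Proof.
rewrite /tau -(Pr_translate P_p h); last exact: measurable_linked.
by congr (Pr _); apply: eq_set => w; apply/propext; exact: linked_translate.
Qed.

Lemma tau_sym x y : tau x y = tau y x.
Proof.
by congr (Pr _); apply: eq_set => w; apply/propext; split; exact: linked_sym.
Qed.

Lemma tau_p0 x y : p = 0 -> x <> y -> tau x y = 0.
Proof.
move=> p0 xy; apply/(negligibleE P); first exact: measurable_linked.
have null_adj z : P.-negligible [set w : config | open_adj w x z].
  have [[e ve]|ne] := pselect (exists e : edge, val e = [set x; z]); last first.
    by apply: (negligibleS _ (negligible_set0 P)) => w [e [ve _]]; apply: ne; exists e.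
  apply: (@negligibleS _ _ _ _ [set w : config | w e = true]) => [w [f [vf wf]]|].
    by have -> : e = f by apply: val_inj; rewrite ve.
  apply/(negligibleE P); first exact: measurable_edge.
  have := Pr_update p_01 P_p e true (@measurableT _ config).
  rewrite p0 /bernoulli_pmf mul0r => /esym; congr (Pr _ = 0).
  by apply/seteqP; split => w /=; [case|].
apply: (negligibleS _ (negligible_exists cG null_adj)) => w /= wxy.
move: xy; elim: (Operators_Properties.clos_rt_rt1n _ _ _ _ wxy) => // a c d ac _ _ _.
by exists c.
Qed.

(** Insertion tolerance along a path. *)
Lemma tau_gt0 x y : 0 < p -> 0 < tau x y.
Proof.
move=> p0; apply: Pr_gt0E; first exact: measurable_linked.
pattern y; apply: (@cayley_ind _ S _ x gS); rewrite ?/(_ y).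
  have -> : [set w : config | linked w x x] = setT.
    by apply/seteqP; split => // w _; exact: linked_refl.
  move=> /(negligibleE P measurableT); rewrite Pr_setT => /eqP.
  by rewrite oner_eq0.
move=> a c ac; apply: contra_not => xc; have [e ve] := mk_edge ac.
apply: (negligibleS _ (negligible_update p_01 P_p e p0 xc)) => w /= xa.
apply: linked_trans (linked_open e xa) _.
by apply: linked_adj; exists e; rewrite updateE.
Qed.

(** Far elements h are handled by mixing, applied to the event that 1 lies in an
    H-infinite cluster; the finitely many others by opening a path. *)
Lemma unique_two_point_bound : infinite_set H ->
  {ae P, forall w : config,
     exists! K : set Gamma, open_clusters w K /\ infinite_along H K} ->
  exists2 c : R, 0 < c & forall h, H h -> c <= tau 1%g h.
Proof.
move=> H_inf ae_unique; pose A w := infinite_along H (open_cluster w 1%g).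
have mA : measurable [set w | A w].
  by apply: measurable_infinite_along => y; exact: measurable_linked.
pose theta := Pr [set w | A w].
have At h w : H h -> A (translate h w) <-> infinite_along H (open_cluster w h^-1%g).
  move=> Hh; rewrite /A -(mulgV h) open_cluster_translate.
  exact: infinite_along_translate.
have theta0 : 0 < theta.
  apply: Pr_gt0E => // nA.
  have : P.-negligible [set: config].
    have nAx : P.-negligible [set w | exists x, A (translate x w)].
      by apply: negligible_exists => // x; exact: negligible_translate.
    apply: (negligibleS _ (negligibleU nAx ae_unique)) => w _.
    have [[K [[[x _ <-] Kinf] _]]|nK] := pselect (exists! K : set Gamma,
      open_clusters w K /\ infinite_along H K); last by right.
    have [f fP] := infinite_alongP; have [y [xy Hy _]] := (fP _).1 Kinf 0.
    left; exists y^-1%g; apply/At; first exact: subgroupV.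
    by rewrite invgK -(open_cluster_eq xy).
  move=> /(negligibleE P measurableT); rewrite Pr_setT => /eqP.
  by rewrite oner_eq0.
have p0 : 0 < p.
  rewrite lt_neqAle; case/andP: p_01 => -> _; rewrite andbT; apply/eqP => p0.
  have : P.-negligible [set w | A w].
    have null y : P.-negligible [set w : config | y <> 1%g /\ linked w 1%g y].
      have [->|y1] := pselect (y = 1%g).
        by apply: (negligibleS _ (negligible_set0 P)) => w [].
      apply: (@negligibleS _ _ _ _ [set w : config | linked w 1%g y]) => [w []//|].
      apply/(negligibleE P); first exact: measurable_linked.
      by apply: tau_p0 => //; exact/nesym.
    apply: (negligibleS _ (negligible_exists cG null)) => w Aw; apply: contrapT => ny.
    apply: Aw; apply: (sub_finite_set _ (finite_set1 1%g)) => y [wy _] /=.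
    by apply: contrapT => y1; apply: ny; exists y.
  by move=> /(negligibleE P mA) A0; move: theta0; rewrite /theta A0 ltxx.
have eps0 : 0 < theta * theta / 2 by rewrite divr_gt0// mulr_gt0.
have [s sP] := mixing p_01 P_p mA mA eps0.
have [c c0 cP] : exists2 c : R, 0 < c & forall h, h \in s -> c <= tau 1%g h^-1%g.
  elim: s {sP} => [|h s [c c0 cP]]; first by exists 1.
  exists (Num.min c (tau 1%g h^-1%g)); first by rewrite lt_min c0 tau_gt0.
  move=> g; rewrite in_cons => /orP[/eqP ->|/cP cg]; first by rewrite ge_min lexx orbT.
  by rewrite ge_min cg.
exists (Num.min c (theta * theta / 2)); first by rewrite lt_min c0.
move=> h Hh; rewrite ge_min; have [hs|hs] := boolP (h^-1%g \in s).
  by have := cP _ hs; rewrite invgK => ->.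
apply/orP; right; have := sP _ hs; rewrite ler_norml => /andP[+ _]; rewrite -/theta => h1.
suff : Pr [set w | A w /\ A (translate h^-1%g w)] <= tau 1%g h by lra.
have mAh : measurable [set w | A w /\ A (translate h^-1%g w)].
  apply: measurable_conj => //; apply: measurable_pre => //.
  exact: measurable_translate.
have mC := @measurable_linked _ S cG 1%g h.
have [N [mN N0 ae_N]] := ae_unique.
have N0' : Pr N = 0 by rewrite /Prob N0.
rewrite -[leRHS]addr0 -N0'; apply: le_trans (PrU_le P mC mN).
apply: le_Pr => //; first exact: measurableU.
move=> w /= [A1 /(At _ _ (subgroupV sH Hh))]; rewrite invgK => Ah.
have [[K [_ uK]]|nK] := pselect (exists! K : set Gamma,
  open_clusters w K /\ infinite_along H K); last by right; apply: ae_N.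
left; change (open_cluster w 1%g h).
have -> : open_cluster w 1%g = open_cluster w h; last exact: linked_refl.
by rewrite -[LHS](uK (open_cluster w 1%g)); [apply: uK|]; split => //;
  [exists h|exists 1%g].
Qed.

End infinite_clusters.

(** * Weighted lists and quadratic forms *)

Section combinations.
Context {d : measure_display} {T : measurableType d} {R : realType}.
Variable P : probability T R.
Local Notation Pr := (Prob P).

Definition comb (I : Type) (s : seq I) (r : I -> R) (Q : I -> Prop) : R :=
  \sum_(i <- s) r i * (`[< Q i >])%:R.

Lemma measurable_comb (I : Type) (s : seq I) (r : I -> R) (A : I -> T -> Prop)
  (Q : R -> Prop) : (forall i, measurable [set w | A i w]) ->
  measurable [set w | Q (comb s r (A^~ w))].
Proof.
move=> mA; elim: s Q => [|i s IHs] Q.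
  by rewrite /comb; under eq_set do rewrite big_nil; exact: measurable_prop.
have -> : [set w | Q (comb (i :: s) r (A^~ w))] = [set w |
   (A i w /\ Q (r i + comb s r (A^~ w))) \/ (~ A i w /\ Q (comb s r (A^~ w)))].
  apply: eq_set => w; apply/propext; rewrite /comb big_cons.
  by case: asboolP => Aw; rewrite ?mulr1 ?mulr0 ?add0r; intuition.
apply: measurable_disj; apply: measurable_conj => //.
  exact: (IHs (fun t => Q (r i + t))).
exact: measurable_compl.
Qed.

Lemma Pr_comb_markov (I : Type) (s : seq I) (r : I -> R) (A : I -> T -> Prop)
  (B : T -> Prop) (c : R) : (forall i, measurable [set w | A i w]) ->
  measurable [set w | B w] -> (forall w, 0 <= comb s r (A^~ w)) ->
  (forall w, B w -> c <= comb s r (A^~ w)) ->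
  c * Pr [set w | B w] <= \sum_(i <- s) r i * Pr [set w | A i w].
Proof.
move=> mA mB A0 AB.
pose A' (o : option I) := if o is Some i then A i else B.
pose r' (o : option I) := if o is Some i then r i else - c.
have mA' o : measurable [set w | A' o w] by case: o.
have := @Pr_comb_ge0 _ _ _ P _ (None :: map Some s) r' A' mA'.
rewrite big_cons big_map /= mulNr addrC subr_ge0; apply => w.
rewrite big_cons big_map; change (0 <= - c * (`[< B w >])%:R + comb s r (A^~ w)).
have := A0 w; have := AB w.
case: asboolP => Bw; rewrite ?mulr1 ?mulr0; [move=> /(_ Bw)|move=> _] => *; lra.
Qed.

Lemma comb_le_Pr (I : Type) (s : seq I) (r : I -> R) (A : I -> T -> Prop)
  (B : T -> Prop) (c : R) : (forall i, measurable [set w | A i w]) ->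
  measurable [set w | B w] -> 0 <= c ->
  (forall w, comb s r (A^~ w) <= 1) ->
  (forall w, ~ B w -> comb s r (A^~ w) <= c) ->
  \sum_(i <- s) r i * Pr [set w | A i w] <= c + Pr [set w | B w].
Proof.
move=> mA mB c0 A0 AB.
pose A' (o : option (option I)) (w : T) :=
  if o is Some o' then if o' is Some i then A i w else B w else True.
pose r' (o : option (option I)) := if o is Some o' then if o' is Some i then - r i else 1 else c.
have mA' o : measurable [set w | A' o w].
  by case: o => [[i|]|] /=; [exact: mA| |exact: measurable_prop].
have := @Pr_comb_ge0 _ _ _ P _ (None :: Some None :: map (Some \o Some) s) r' A' mA'.
rewrite !big_cons big_map /= mul1r.
have -> : \sum_(i <- s) - r i * Pr [set w | A i w] = - \sum_(i <- s) r i * Pr [set w | A i w].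
  by rewrite -sumrN; apply: eq_bigr => i _; rewrite mulNr.
have -> : [set _ : T | True] = setT by apply/seteqP; split.
rewrite Pr_setT mulr1 addrA subr_ge0; apply => w.
rewrite !big_cons big_map /= asboolT// mulr1 mul1r.
have -> : \sum_(i <- s) - r i * (`[< A i w >])%:R = - comb s r (A^~ w).
  by rewrite -sumrN; apply: eq_bigr => i _; rewrite mulNr.
have := A0 w; have := AB w; case: asboolP => Bw; [move=> _|move=> /(_ Bw)] => *;
  rewrite ?mulr1n ?mulr0n; lra.
Qed.

End combinations.

Section energy.
Variables (Gamma : groupType) (R : realType).
Implicit Types (c d : seq (R * Gamma)) (h : Gamma) (A : set Gamma).

Definition mass c A : R := comb c fst (fun u => A u.2).

Definition neg c : seq (R * Gamma) := [seq (- x.1, x.2) | x <- c].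
Definition halve c : seq (R * Gamma) := [seq (x.1 / 2, x.2) | x <- c].
Definition shift_list h c : seq (R * Gamma) := [seq (x.1, h * x.2)%g | x <- c].

(** With the two-point function for t, [qform t c c] is the energy: the expected
    sum over the clusters of the squares of the masses given by c. *)
Definition qform (t : Gamma -> Gamma -> R) c d : R :=
  \sum_(x <- c) \sum_(y <- d) x.1 * y.1 * t x.2 y.2.

Section bilinear.
Variable t : Gamma -> Gamma -> R.

Lemma qform_catl c c' d : qform t (c ++ c') d = qform t c d + qform t c' d.
Proof. by rewrite /qform big_cat. Qed.

Lemma qform_negl c d : qform t (neg c) d = - qform t c d.
Proof.
rewrite /qform /neg big_map -sumrN; apply: eq_bigr => x _; rewrite -sumrN.
by apply: eq_bigr => y _ /=; rewrite !mulNr.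
Qed.

Lemma qform_halvel c d : qform t (halve c) d = qform t c d / 2.
Proof.
rewrite /qform /halve big_map mulr_suml; apply: eq_bigr => x _; rewrite mulr_suml.
by apply: eq_bigr => y _ /=; ring.
Qed.

Hypothesis tC : forall x y, t x y = t y x.

Lemma qform_sym c d : qform t c d = qform t d c.
Proof.
rewrite /qform exchange_big; apply: eq_bigr => x _; apply: eq_bigr => y _.
by rewrite tC [x.1 * _]mulrC.
Qed.

Lemma qform_shift h c d : (forall x y, t (h * x)%g (h * y)%g = t x y) ->
  qform t (shift_list h c) (shift_list h d) = qform t c d.
Proof.
move=> th; rewrite /qform big_map; apply: eq_bigr => x _.
by rewrite big_map; apply: eq_bigr => y _ /=; rewrite th.
Qed.

Lemma qform_diff c d :
  qform t (c ++ neg d) (c ++ neg d) = qform t c c + qform t d d - 2 * qform t c d.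
Proof.
rewrite qform_catl qform_negl ![qform t _ (c ++ neg d)]qform_sym !qform_catl !qform_negl.
by rewrite (qform_sym d c); ring.
Qed.

Lemma qform_mid c d :
  qform t (halve (c ++ d)) (halve (c ++ d)) = (qform t c c + qform t d d + 2 * qform t c d) / 4.
Proof.
rewrite qform_halvel qform_sym qform_halvel qform_catl ![qform t _ (c ++ d)]qform_sym.
by rewrite !qform_catl (qform_sym d c); field.
Qed.

End bilinear.

Lemma mass_cat c d A : mass (c ++ d) A = mass c A + mass d A.
Proof. by rewrite /mass /comb big_cat. Qed.

Lemma mass_neg c A : mass (neg c) A = - mass c A.
Proof.
by rewrite /mass /comb big_map -sumrN; apply: eq_bigr => x _ /=; rewrite mulNr.
Qed.

Lemma mass_shift h c A : mass (shift_list h c) A = mass c (translate_set h^-1%g A).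
Proof.
rewrite /mass /comb big_map; apply: eq_bigr => x _ /=; congr (_ * (nat_of_bool _)%:R).
by apply: asbool_equiv_eq; rewrite translate_setP invgK.
Qed.

(** Splitting c into equivalence classes exhibits the form as the sum of the
    squared masses of the classes. *)
Lemma qform_equiv (E : Gamma -> Gamma -> Prop) c x0 : (forall x, E x x) ->
  (forall x y, E x y -> E y x) -> (forall x y z, E x y -> E y z -> E x z) ->
  mass c (E x0) ^+ 2 <= qform (fun x y => (`[< E x y >])%:R) c c.
Proof.
move=> Er Es Et; set t := fun x y => _.
pose f z (x : R * Gamma) := ~~ `[< E z x.2 >].
have split_class z c' : qform t c' c' =
    mass c' (E z) ^+ 2 + qform t [seq u <- c' | f z u] [seq u <- c' | f z u].
  have inE x : ~~ f z x -> \sum_(y <- c') x.1 * y.1 * t x.2 y.2 = x.1 * mass c' (E z).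
    move=> /negPn/asboolP zx; rewrite /mass /comb mulr_sumr; apply: eq_bigr => y _.
    rewrite -mulrA /t; congr (_ * (_ * (nat_of_bool _)%:R)).
    by apply: asbool_equiv_eq; split; [exact: Et|exact/Et/Es].
  have outE x : f z x ->
      \sum_(y <- c') x.1 * y.1 * t x.2 y.2 = \sum_(y <- c' | f z y) x.1 * y.1 * t x.2 y.2.
    move=> /asboolPn zx; rewrite (bigID (f z)) /= addrC big1 ?add0r// => y.
    move=> /negPn/asboolP zy; rewrite /t asboolF ?mulr0// => xy.
    by apply: zx; apply: Et zy _; exact: Es.
  rewrite /qform (bigID (f z)) /= addrC; congr (_ + _).
    under eq_bigr do rewrite inE//.
    rewrite -mulr_suml expr2; congr (_ * _).
    rewrite /mass /comb [RHS](bigID (f z)) /= [X in X + _]big1 ?add0r; last first.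
      by move=> x; rewrite /f => /negPf ->; rewrite mulr0.
    by apply: eq_bigr => x; rewrite /f => /negPn ->; rewrite mulr1.
  rewrite big_filter; apply: eq_bigr => x xf; rewrite big_filter.
  exact: outE.
have qform_ge0 n c' : (size c' <= n)%N -> 0 <= qform t c' c'.
  elim: n c' => [|n IHn] [|[r z] c'] //= cn; try by rewrite /qform big_nil.
  rewrite (split_class z) addr_ge0 ?sqr_ge0//; apply: IHn.
  rewrite /= /f /= asboolT //=.
  by rewrite size_filter; apply: leq_trans (count_size _ _) _; rewrite -ltnS.
by rewrite (split_class x0) lerDl; exact: qform_ge0 (leqnn _).
Qed.

Variables (H : set Gamma) (sH : is_subgroup H).

Definition weight_list c :=
  (forall x, x \in c -> 0 <= x.1 /\ H x.2) /\ \sum_(x <- c) x.1 = 1.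

Lemma weight_mass_bounds c A : weight_list c -> 0 <= mass c A <= 1.
Proof.
move=> [cH c1]; rewrite /mass /comb; apply/andP; split.
  rewrite big_seq; apply: sumr_ge0 => x /cH[x0 _].
  by rewrite mulr_ge0.
rewrite -[leRHS]c1 big_seq [leRHS]big_seq; apply: ler_sum => x /cH[x0 _].
by case: asboolP => _; rewrite ?mulr1 ?mulr0.
Qed.

Lemma mass_subset c A B : weight_list c -> A `<=` B -> mass c A <= mass c B.
Proof.
move=> [cH _] AB; rewrite /mass /comb big_seq [leRHS]big_seq; apply: ler_sum => x /cH[x0 _].
apply: ler_wpM2l => //; rewrite ler_nat.
by case: asboolP => // /AB; case: asboolP.
Qed.

Lemma mass_union c A B : weight_list c -> mass c (A `|` B) <= mass c A + mass c B.
Proof.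
move=> [cH _]; rewrite /mass /comb -big_split /= big_seq [leRHS]big_seq.
apply: ler_sum => x /cH[x0 _].
rewrite -mulrDr; apply: ler_wpM2l => //; rewrite -natrD ler_nat.
by case: (asboolP ((A `|` B) x.2)) => // -[h|h]; rewrite (asboolT h)// addn1.
Qed.

Lemma mass_disjoint c A B : A `&` B = set0 -> mass c (A `|` B) = mass c A + mass c B.
Proof.
move=> AB; rewrite /mass /comb -big_split /=; apply: eq_bigr => x _.
rewrite -mulrDr -natrD; congr (_ * _%:R).
have nAB : ~ (A x.2 /\ B x.2) by move=> h; have : (A `&` B) x.2 by []; rewrite AB.
case: (asboolP (A x.2)) => a; case: (asboolP (B x.2)) => b.
- by case: nAB.
- by rewrite asboolT//; left.
- by rewrite asboolT//; right.
- by rewrite asboolF// => -[].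
Qed.

Lemma weight_shift h c : H h -> weight_list c -> weight_list (shift_list h c).
Proof.
move=> Hh [cH c1]; split; last by rewrite big_map.
by move=> _ /mapP[x /cH[x0 Hx] ->]; split => //=; exact: subgroupM.
Qed.

Lemma weight_mid c d : weight_list c -> weight_list d -> weight_list (halve (c ++ d)).
Proof.
move=> [cH c1] [dH d1]; split.
  move=> _ /mapP[x + ->]; rewrite mem_cat => /orP[/cH|/dH] [x0 Hx]; split => //=;
    by rewrite divr_ge0.
by rewrite big_map -mulr_suml big_cat /= c1 d1; field.
Qed.

(** The law of the inverse of a c-distributed element times an independent one. *)
Definition symmetrization c : seq (R * Gamma) :=
  [seq (x.1 * y.1, (x.2^-1 * y.2)%g) | x <- c, y <- c].

Lemma weight_symmetrization c : weight_list c -> weight_list (symmetrization c).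
Proof.
move=> [cH c1]; split.
  move=> _ /allpairsP[[x y] /= [/cH[x0 Hx] /cH[y0 Hy] ->]] /=.
  by rewrite mulr_ge0//; split => //; apply: subgroupM => //; exact: subgroupV.
rewrite big_allpairs_dep /=; under eq_bigr do rewrite -mulr_sumr c1 mulr1.
exact: c1.
Qed.

Lemma symmetrization_inv c (f : Gamma -> R) :
  \sum_(z <- symmetrization c) z.1 * f (z.2)^-1%g =
  \sum_(z <- symmetrization c) z.1 * f z.2.
Proof.
rewrite !big_allpairs_dep /= exchange_big /=; apply: eq_bigr => x _; apply: eq_bigr => y _.
by rewrite invgM invgK [x.1 * _]mulrC.
Qed.

(** Convexity: the symmetrization is a mixture of translates of c, all with the
    energy of c. *)
Lemma qform_symmetrization t c : (forall x y, t x y = t y x) ->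
  (forall h x y, t (h * x)%g (h * y)%g = t x y) ->
  (forall d, 0 <= qform t d d) -> weight_list c ->
  qform t (symmetrization c) (symmetrization c) <= qform t c c.
Proof.
move=> tC th t0 [cH c1].
have -> : qform t (symmetrization c) (symmetrization c) =
  \sum_(x <- c) \sum_(x' <- c) x.1 * x'.1 *
    qform t (shift_list x.2^-1%g c) (shift_list x'.2^-1%g c).
  rewrite /qform big_allpairs_dep; apply: eq_bigr => x _.
  under eq_bigr do rewrite big_allpairs_dep.
  rewrite exchange_big; apply: eq_bigr => x' _.
  rewrite big_map mulr_sumr; apply: eq_bigr => y _.
  by rewrite big_map mulr_sumr; apply: eq_bigr => y' _ /=; ring.
have -> : qform t c c = \sum_(x <- c) \sum_(x' <- c) x.1 * x'.1 * qform t c c.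
  rewrite -[LHS]mul1r -{1}c1 mulr_suml; apply: eq_bigr => x _.
  by rewrite -mulr_suml -mulr_sumr c1 mulr1.
rewrite big_seq [leRHS]big_seq; apply: ler_sum => x /cH[x0 _].
rewrite big_seq [leRHS]big_seq; apply: ler_sum => x' /cH[x'0 _].
apply: ler_wpM2l; first exact: mulr_ge0.
have := t0 (shift_list x.2^-1%g c ++ neg (shift_list x'.2^-1%g c)).
by rewrite qform_diff// !qform_shift//; lra.
Qed.

End energy.

(** * Symmetric measures of nearly minimal energy *)

Section real_sequences.
Variable R : realType.
Implicit Types u : nat -> R.
Local Notation "'half'" := (2^-1 : R).

Lemma cvg_epsilonP u (l : R) : u n @[n --> \oo] --> l <->
  forall e, 0 < e -> exists N, forall n, (N <= n)%N -> `|u n - l| < e.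
Proof.
split.
  move=> /cvgrPdist_lt ul e /ul [N _ Nul]; exists N => n Nn.
  by rewrite distrC; exact: Nul.
move=> ul; apply/cvgrPdist_lt => e /ul[N Nul]; exists N => // n Nn /=.
by rewrite distrC; exact: Nul.
Qed.

Lemma half_expS n : half ^+ n = 2 * half ^+ n.+1.
Proof. by rewrite exprS mulrA divff ?mul1r// pnatr_eq0. Qed.

Lemma half_exp_gt0 n : 0 < half ^+ n.
Proof. by rewrite exprn_gt0// invr_gt0. Qed.

Lemma cvg_half_exp e : 0 < e -> exists N, forall n, (N <= n)%N -> half ^+ n < e.
Proof.
move=> e0; have h1 : `|half| < 1 by rewrite ger0_norm ?invr_ge0// invf_lt1// ltr1n.
have /cvg_epsilonP/(_ _ e0)[N hN] := cvg_expr h1.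
by exists N => n /hN; rewrite subr0 ger0_norm// ltW// half_exp_gt0.
Qed.

Lemma exists_invS_lt (e : R) : 0 < e -> exists k : nat, k.+1%:R^-1 < e.
Proof.
move=> e0; have [k _ ke] := near_infty_natSinv_lt (PosNum e0).
by exists k; exact: (ke k (leqnn k)).
Qed.

(** Subtracting twice the geometric sequence makes u eventually monotone. *)
Lemma cvg_geometric_increments u N : (forall n, u n <= 1) ->
  (forall n, (N <= n)%N -> `|u n.+1 - u n| < half ^+ n) -> exists l : R, u n @[n --> \oo] --> l.
Proof.
move=> u1 uN; pose v n := u n - 2 * half ^+ n.
have vnd : nondecreasing_seq (fun n => v (n + N)%N).
  apply/nondecreasing_seqP => n; rewrite /v addSn (half_expS (n + N)%N).
  have := uN (n + N)%N (leq_addl _ _); rewrite ltr_norml (half_expS (n + N)%N).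
  by move=> /andP[]; lra.
have vub : has_ubound (range (fun n => v (n + N)%N)).
  exists 1 => _ [n _ <-]; rewrite /v; have := u1 (n + N)%N.
  by have := half_exp_gt0 (n + N)%N; lra.
have /cvg_ex[l vl] := nondecreasing_is_cvgn vnd vub.
exists l; apply/cvg_epsilonP => e e0; have e2 : 0 < e / 4 by rewrite divr_gt0.
have /cvg_epsilonP/(_ _ e2)[M vM] := vl.
have [M' hM'] := cvg_half_exp e2.
exists (M + N + M')%N => n Mn.
have := vM (n - N)%N; rewrite subnK; last by lia.
have := hM' n; move=> /(_ ltac:(lia)) hn /(_ ltac:(lia)).
rewrite /v; have := half_exp_gt0 n.
by move=> ?; rewrite !ltr_norml => /andP[? ?]; apply/andP; split; lra.
Qed.

End real_sequences.

Section minimizing_measures.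
Variables (Gamma : groupType) (S : set Gamma) (H : set Gamma).
Variables (sH : is_subgroup H) (cG : countable [set: Gamma]).
Local Notation config := (config S).
Variables (R : realType) (p : R) (p_01 : 0 <= p <= 1).
Variable P : probability config R.
Hypothesis P_p : bernoulli_percolation p P.
Local Notation Pr := (Prob P).
Local Notation tau := (tau P).
Local Notation half := (2^-1 : R).
Local Notation K := (@open_cluster Gamma S).
Implicit Types (w : config) (x y h : Gamma) (c d : seq (R * Gamma)).

Lemma measurable_mass c (L : config -> set Gamma) (Q : R -> Prop) :
  (forall y, measurable [set w | L w y]) -> measurable [set w | Q (mass c (L w))].
Proof.
move=> mL; apply: (@measurable_comb _ _ _ _ c fst (fun u w => L w u.2) Q) => u.
exact: mL.
Qed.

Let mK x y : measurable [set w | K w x y] := measurable_linked cG x y.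

Lemma energy_linked w c : qform (fun x y => (`[< K w x y >])%:R) c c =
  comb [seq (u, v) | u <- c, v <- c] (fun uv => uv.1.1 * uv.2.1)
    (fun uv => K w uv.1.2 uv.2.2).
Proof. by rewrite /qform /comb big_allpairs. Qed.

Lemma tau_qformE c : qform tau c c =
  \sum_(uv <- [seq (u, v) | u <- c, v <- c])
    uv.1.1 * uv.2.1 * Pr [set w | K w uv.1.2 uv.2.2].
Proof. by rewrite /qform big_allpairs. Qed.

Lemma linked_mass_le w c x :
  mass c (K w x) ^+ 2 <= qform (fun x y => (`[< K w x y >])%:R) c c.
Proof.
apply: qform_equiv; [exact: linked_refl|exact: linked_sym|].
by move=> a a' a''; exact: linked_trans.
Qed.

(** Chebyshev: the squared mass of a single cluster is at most the sum over all
    clusters, whose expectation is the energy. *)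
Lemma energy_chebyshev c x (e : R) : 0 < e ->
  e ^+ 2 * Pr [set w | e <= `|mass c (K w x)|] <= qform tau c c.
Proof.
move=> e0; rewrite tau_qformE.
apply: (@Pr_comb_markov _ _ _ _ _ _ _ (fun uv w => K w uv.1.2 uv.2.2)) => //.
- by apply: (measurable_mass c (fun t => e <= `|t|)); exact: mK.
- by move=> w; rewrite -energy_linked; exact: le_trans (sqr_ge0 _) (linked_mass_le w c 1%g).
move=> w ew; rewrite -energy_linked; apply: le_trans (linked_mass_le w c x).
by rewrite -[leRHS]real_normK ?num_real// lerXn2r// ?nnegrE// ltW.
Qed.

Lemma energy_ge0 c : 0 <= qform tau c c.
Proof.
have := energy_chebyshev c 1%g (@ltr01 R); apply: le_trans.
by rewrite mulr_ge0// ?sqr_ge0// Pr_ge0.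
Qed.

Local Notation weight_list := (@weight_list Gamma R H).

Definition min_energy : R := inf [set qform tau c c | c in [set c | weight_list c]].

Lemma weight_unit : weight_list [:: (1, 1%g)].
Proof.
split; last by rewrite big_seq1.
by move=> x; rewrite inE => /eqP -> /=; split => //; exact: subgroup1.
Qed.

Lemma min_energy_le c : weight_list c -> min_energy <= qform tau c c.
Proof.
move=> wc; apply: ge_inf; last by exists c.
by exists 0 => _ [d _ <-]; exact: energy_ge0.
Qed.

(** The parallelogram identity, with the midpoint of c and d as competitor. *)
Lemma near_minimizers_close c d (e : R) : weight_list c -> weight_list d ->
  qform tau c c <= min_energy + e -> qform tau d d <= min_energy + e ->
  qform tau (c ++ neg d) (c ++ neg d) <= 4 * e.
Proof.
move=> wc wd ce de; rewrite qform_diff; last exact: tau_sym.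
have := min_energy_le (weight_mid wc wd); rewrite qform_mid; last exact: tau_sym.
by lra.
Qed.

(** The symmetry of [b n] serves to compare the two directions of a chain of sites.
    The exponent leaves room for the two factors
    half ^+ n that Chebyshev's inequality costs at threshold half ^+ n. *)
Definition minimizing (b : nat -> seq (R * Gamma)) := forall n,
  [/\ weight_list (b n),
      forall f : Gamma -> R, \sum_(z <- b n) z.1 * f (z.2)^-1%g = \sum_(z <- b n) z.1 * f z.2 &
      qform tau (b n) (b n) <= min_energy + half ^+ (3 * n + 3)].

Lemma exists_minimizing : exists b, minimizing b.
Proof.
suff /choice[b bP] n : exists c, [/\ weight_list c,
    forall f : Gamma -> R, \sum_(z <- c) z.1 * f (z.2)^-1%g = \sum_(z <- c) z.1 * f z.2 &
    qform tau c c <= min_energy + half ^+ (3 * n + 3)] by exists b.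
have [|_ [c wc <-] cE] := @inf_adherent _ [set qform tau c c | c in [set c | weight_list c]]
    _ (half_exp_gt0 R (3 * n + 3)).
  split; first by exists (qform tau [:: (1, 1%g)] [:: (1, 1%g)]), [:: (1, 1%g)] => //;
    exact: weight_unit.
  by exists 0 => _ [d _ <-]; exact: energy_ge0.
exists (symmetrization c); split; first exact: weight_symmetrization.
- exact: symmetrization_inv.
apply: le_trans (ltW cE); apply: (qform_symmetrization (H := H)) => //.
- exact: tau_sym.
- exact: tau_mul.
- exact: energy_ge0.
Qed.

(** Chebyshev and Borel-Cantelli. *)
Lemma io_negligible (c : nat -> seq (R * Gamma)) x :
  (forall n, qform tau (c n) (c n) <= half ^+ (3 * n + 1)) ->
  P.-negligible [set w | forall N, exists n,
    (N <= n)%N /\ half ^+ n <= `|mass (c n) (K w x)|].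
Proof.
move=> cE; pose F n := [set w | half ^+ n <= `|mass (c n) (K w x)|].
have mF n : measurable (F n).
  by apply: (measurable_mass (c n) (fun t => half ^+ n <= `|t|)); exact: mK.
have PF n : Pr (F n) <= half ^+ n.+1.
  have h0 := half_exp_gt0 R n.
  have := le_trans (energy_chebyshev (c n) x h0) (cE n).
  have -> : half ^+ (3 * n + 1) = (half ^+ n) ^+ 2 * half ^+ n.+1.
    by rewrite -exprM -exprD; congr (_ ^+ _); lia.
  by rewrite ler_pM2l// exprn_gt0.
have sF : (\sum_(0 <= n <oo) P (F n) < +oo)%E.
  apply: (@le_lt_trans _ _ 1%:E); last exact: ltry.
  apply: lime_le; first exact: is_cvg_nneseries.
  apply: nearW => n; apply: (@le_trans _ _ (1 - half ^+ n)%:E); last first.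
    by rewrite lee_fin; have := half_exp_gt0 R n; lra.
  elim: n => [|n IHn]; first by rewrite big_nil expr0 subrr.
  rewrite big_nat_recr//=; apply: le_trans (leeD IHn (_ : _ <= (half ^+ n.+1)%:E)%E) _.
    by rewrite PrE// lee_fin; exact: PF.
  by rewrite -EFinD lee_fin (half_expS R n); lra.
have F0 := lim_sup_set_cvg0 mF sF.
exists (lim_sup_set F); split => //.
  by apply: bigcapT_measurable => n; apply: bigcup_measurable => k _.
by move=> w wF N _; have [n [Nn Fn]] := wF N; exists n.
Qed.

(** Quantifying over the translates of [b n] makes density invariant under H by
    definition, and not only almost surely on clusters. *)
Definition has_density (b : nat -> seq (R * Gamma)) (A : set Gamma) (F : R) :=
  forall h, H h -> mass (shift_list h (b n)) A @[n --> \oo] --> F.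

(** Consecutive measures, and translates of a same measure, are near-minimisers of
    the energy, so their difference has a small energy and hence gives a small mass
    to each cluster. *)
Lemma clusters_have_density b : minimizing b ->
  P.-negligible [set w | exists x, ~ exists F, has_density b (K w x) F].
Proof.
move=> bmin; apply: negligible_exists => // x.
pose io (c : nat -> seq (R * Gamma)) (w : config) := forall N, exists n,
    (N <= n)%N /\ half ^+ n <= `|mass (c n) (K w x)|.
pose c0 n := b n.+1 ++ neg (b n).
pose c1 h n := shift_list h (b n) ++ neg (b n).
have E4 n : half ^+ (3 * n + 1) = 4 * half ^+ (3 * n + 3).
  by rewrite !addn1 !addn3 (half_expS R (3 * n).+1) (half_expS R (3 * n).+2); lra.
have n0 : P.-negligible [set w | io c0 w].
  apply: io_negligible => n; rewrite E4.
  have [w1 _ e1] := bmin n.+1; have [w0 _ e0] := bmin n.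
  apply: near_minimizers_close => //; apply: le_trans e1 _; rewrite lerD2l.
  by apply: ler_wiXn2l; rewrite ?invr_ge0 ?invf_le1 ?ler1n//; lia.
have n1 : P.-negligible [set w | exists h, H h /\ io (c1 h) w].
  apply: negligible_exists => // h; have [Hh|nHh] := pselect (H h); last first.
    by apply: (negligibleS _ (negligible_set0 P)) => w [].
  apply: (@negligibleS _ _ _ _ [set w | io (c1 h) w]); first by move=> w [].
  apply: io_negligible => n; rewrite E4; have [w0 _ e0] := bmin n.
  apply: near_minimizers_close => //; first exact: weight_shift.
  by rewrite qform_shift// => y z; exact: tau_mul.
apply: (negligibleS _ (negligibleU n0 n1)) => w nF.
apply: contrapT => /not_orP[/= nio0 nio1]; apply: nF.
have eventually (cs : nat -> seq (R * Gamma)) : ~ io cs w -> exists N, forall n, (N <= n)%N ->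
    `|mass (cs n) (K w x)| < half ^+ n.
  move=> nio; apply: contrapT => nN; apply: nio => N; apply: contrapT => nn.
  by apply: nN; exists N => n Nn; rewrite ltNge; apply/negP => ?; apply: nn; exists n.
have [N0 hN0] := eventually _ nio0.
have [||F bF] := @cvg_geometric_increments _ (fun n => mass (b n) (K w x)) N0.
- by move=> n; have [w0 _ _] := bmin n; case/andP: (weight_mass_bounds (K w x) w0).
- by move=> n /hN0; rewrite mass_cat mass_neg.
exists F => h Hh; apply/cvg_epsilonP => e e0; have e2 : 0 < e / 2 by rewrite divr_gt0.
have [|N1 hN1] := eventually (c1 h); first by move=> ioh; apply: nio1; exists h.
have /cvg_epsilonP/(_ _ e2)[N2 hN2] := bF.
have [N3 hN3] := cvg_half_exp e2.
exists (N1 + N2 + N3)%N => n Nn.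
have := hN1 n => /(_ ltac:(lia)); rewrite mass_cat mass_neg => d1.
have d2 := hN2 n ltac:(lia); have d3 := hN3 n ltac:(lia).
move: d1 d2; rewrite !ltr_norml => /andP[? ?] /andP[? ?].
by apply/andP; split; lra.
Qed.

End minimizing_measures.

(** * Clusters of positive density *)

Section heavy_clusters.
Variables (Gamma : groupType) (S : set Gamma) (H : set Gamma).
Variables (sH : is_subgroup H) (cG : countable [set: Gamma]) (gS : generates S).
Local Notation config := (config S).
Variables (R : realType) (p : R) (p_01 : 0 <= p <= 1) (p_gt0 : 0 < p).
Variable P : probability config R.
Hypothesis P_p : bernoulli_percolation p P.
Local Notation Pr := (Prob P).
Local Notation tau := (tau P).
Local Notation K := (@open_cluster Gamma S).
Implicit Types (w : config) (x y h : Gamma) (A B : set Gamma).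

(** Insertion tolerance along a path, as a map on configurations. *)
Lemma merge_map x y : exists phi : config -> config,
  [/\ forall N : set config, P.-negligible N -> P.-negligible [set w | N (phi w)],
      forall w, linked (phi w) x y &
      forall w a c, linked w a c -> linked (phi w) a c].
Proof.
pattern y; apply: (@cayley_ind _ S _ x gS).
  by exists id; split => // w; exact: linked_refl.
move=> a c ac [phi [phi0 phixy phiS]]; have [e ve] := mk_edge ac.
exists (fun w => update e true (phi w)); split.
- by move=> N N0; apply: (phi0 [set w | N (update e true w)]); by apply: (negligible_update p_01 P_p e p_gt0 N0).
- move=> w; apply: linked_trans (linked_open e (phixy w)) _.
  by apply: linked_adj; exists e; rewrite updateE.
- by move=> w u v /phiS; exact: linked_open.
Qed.

Variables (b : nat -> seq (R * Gamma)).
Hypothesis b_min : minimizing H P b.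

Local Notation has_density := (has_density H b).

Lemma b_weight n : weight_list H (b n).
Proof. by have [] := b_min n. Qed.

Lemma b_shift_weight h n : H h -> weight_list H (shift_list h (b n)).
Proof. by move=> Hh; apply: weight_shift => //; exact: b_weight. Qed.

Lemma has_density_le A B F F' : A `<=` B -> has_density A F -> has_density B F' -> F <= F'.
Proof.
move=> AB /(_ _ (subgroup1 sH)) AF /(_ _ (subgroup1 sH)) BF.
apply: (ler_cvg_to AF BF); apply: nearW => n.
by apply: mass_subset AB; apply: b_shift_weight; exact: subgroup1.
Qed.

Lemma has_density_disjoint A B F F' : A `&` B = set0 ->
  has_density A F -> has_density B F' -> has_density (A `|` B) (F + F').
Proof.
move=> AB AF BF h Hh; under eq_fun do rewrite mass_disjoint//.
by apply: cvgD; [exact: AF|exact: BF].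
Qed.

Lemma has_density_ge0 A F : has_density A F -> 0 <= F.
Proof.
move=> /(_ _ (subgroup1 sH)) AF; have : (fun=> 0 : R) @ \oo --> (0 : R) by exact: cvg_cst.
move=> c0; apply: (ler_cvg_to c0 AF); apply: nearW => n.
by case/andP: (weight_mass_bounds A (b_shift_weight n (subgroup1 sH))).
Qed.

Lemma has_density_translate g A F : H g ->
  has_density (translate_set g A) F <-> has_density A F.
Proof.
suff imp k B : H k -> has_density B F -> has_density (translate_set k B) F.
  move=> Hg; split; last exact: imp.
  by move=> /(imp g^-1%g); rewrite translate_setK; apply; exact: subgroupV.
move=> Hk BF h Hh.
have E : (fun n => mass (shift_list h (b n)) (translate_set k B)) =
    (fun n => mass (shift_list (k^-1 * h)%g (b n)) B).
  apply/funext => n; rewrite !mass_shift; congr (mass _ _).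
  by apply/seteqP; split => y; rewrite !translate_setP !invgM !invgK -mulgA.
by rewrite E; apply: BF; apply: subgroupM => //; exact: subgroupV.
Qed.

(** Light sets form an ideal that is invariant under H. *)
Definition light A := has_density A 0.

Lemma lightS A B : A `<=` B -> light B -> light A.
Proof.
move=> AB lB h Hh.
apply: (@squeeze_cvgr _ _ _ _ (fun=> 0) (fun n => mass (shift_list h (b n)) B)).
- apply: nearW => n; have wh := b_shift_weight n Hh.
  by case/andP: (weight_mass_bounds A wh) => -> _; exact: mass_subset wh AB.
- exact: cvg_cst.
- exact: lB.
Qed.

Lemma lightU A B : light A -> light B -> light (A `|` B).
Proof.
move=> lA lB h Hh; have AB : mass (shift_list h (b n)) A + mass (shift_list h (b n)) B
    @[n --> \oo] --> (0 : R) by rewrite -[X in _ --> X]addr0; apply: cvgD; [exact: lA|exact: lB].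
apply: (@squeeze_cvgr _ _ _ _ (fun=> 0) _ _ _ _ (cvg_cst _) AB).
apply: nearW => n; have wh := b_shift_weight n Hh.
by case/andP: (weight_mass_bounds (A `|` B) wh) => -> _; exact: mass_union wh.
Qed.

Lemma light_translate g A : H g -> light (translate_set g A) <-> light A.
Proof. exact: has_density_translate. Qed.

Lemma measurable_light (L : config -> set Gamma) :
  (forall y, measurable [set w | L w y]) -> measurable [set w | light (L w)].
Proof.
move=> mL; have -> : [set w | light (L w)] = [set w | forall h, H h -> forall k : nat,
    exists N, forall n, (N <= n)%N -> `|mass (shift_list h (b n)) (L w) - 0| < k.+1%:R^-1].
  apply: eq_set => w; apply/propext; split => [lL h Hh k|lL h Hh].
    by have /cvg_epsilonP := lL h Hh; apply; rewrite invr_gt0.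
  apply/cvg_epsilonP => e e0; have [k ke] := exists_invS_lt e0.
  have [N hN] := lL h Hh k; exists N => n /hN /lt_trans; apply.
  exact: ke.
apply: measurable_all => // h; apply: measurable_imply; first exact: measurable_prop.
apply: measurable_all => // k; apply: measurable_ex => // N.
apply: measurable_all => // n; apply: measurable_imply; first exact: measurable_prop.
by apply: (measurable_mass _ (fun t => `|t - 0| < k.+1%:R^-1)).
Qed.

Definition densities_exist w := forall x, exists F, has_density (K w x) F.

Lemma densities_exist_ae : P.-negligible [set w | ~ densities_exist w].
Proof.
have n0 := clusters_have_density sH cG p_01 P_p b_min.
by apply: (negligibleS _ n0) => w /existsNP.
Qed.

(** A lower density is used, along all the translates of b, so that this event is
    exactly invariant under H and defined even where densities fail to exist. *)
Definition dense_cluster (q : R) w := exists x, forall h, H h ->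
  exists N, forall n, (N <= n)%N -> q <= mass (shift_list h (b n)) (K w x).

Lemma measurable_dense_cluster q : measurable [set w | dense_cluster q w].
Proof.
apply: measurable_ex => // x; apply: measurable_all => // h.
apply: measurable_imply; first exact: measurable_prop.
apply: measurable_ex => // N; apply: measurable_all => // n.
apply: measurable_imply; first exact: measurable_prop.
apply: (measurable_mass _ (fun t => q <= t)) => y; exact: measurable_linked.
Qed.

Lemma dense_cluster_le q q' w : q <= q' -> dense_cluster q' w -> dense_cluster q w.
Proof.
move=> qq' [x qx]; exists x => h /qx[N hN]; exists N => n /hN.
exact: le_trans.
Qed.

Lemma dense_cluster_translate q g w : H g ->
  dense_cluster q (translate g w) <-> dense_cluster q w.
Proof.
suff imp k w' : H k -> dense_cluster q w' -> dense_cluster q (translate k w').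
  move=> Hg; split; last exact: imp.
  by move=> /(imp g^-1%g); rewrite translateK; apply; exact: subgroupV.
move=> Hk [x qx]; exists (k * x)%g => h Hh.
have [N hN] := qx (k^-1 * h)%g (subgroupM sH (subgroupV sH Hk) Hh).
exists N => n /hN; congr (_ <= _); rewrite !mass_shift; congr (mass _ _).
rewrite open_cluster_translate.
by apply/seteqP; split => y; rewrite !translate_setP !invgM !invgK -mulgA.
Qed.

Lemma density_dense_cluster w x q F : has_density (K w x) F -> q < F -> dense_cluster q w.
Proof.
move=> xF qF; exists x => h Hh; have /cvg_epsilonP := xF h Hh.
have Fq : 0 < F - q by rewrite subr_gt0.
move=> /(_ _ Fq)[N hN]; exists N => n /hN.
by rewrite ltr_norml => /andP[]; lra.
Qed.

Hypothesis H_inf : infinite_set H.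

Lemma dense_cluster_01 q :
  Pr [set w | dense_cluster q w] = 0 \/ Pr [set w | dense_cluster q w] = 1.
Proof.
apply: (zero_one p_01 P_p H_inf (measurable_dense_cluster q)) => h w.
exact: dense_cluster_translate.
Qed.

Definition max_density : R := sup [set q | Pr [set w | dense_cluster q w] = 1].

Let dense_set_sup : has_sup [set q | Pr [set w | dense_cluster q w] = 1].
Proof.
split.
  exists 0 => /=; have -> : [set w | dense_cluster 0 w] = setT; last exact: Pr_setT.
  apply/seteqP; split => // w _; exists 1%g => h Hh; exists 0 => n _.
  by case/andP: (weight_mass_bounds (K w 1%g) (b_shift_weight n Hh)).
exists 1 => q /= q1; rewrite leNgt; apply/negP => q_gt1.
have : [set w | dense_cluster q w] = set0.
  apply/seteqP; split => // w [x /(_ _ (subgroup1 sH))[N /(_ N (leqnn N))]].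
  apply/negP; rewrite -ltNge; apply: le_lt_trans q_gt1.
  by case/andP: (weight_mass_bounds (K w x) (b_shift_weight N (subgroup1 sH))).
by move=> q0; move: q1; rewrite q0 Pr_set0 => /esym/eqP; rewrite oner_eq0.
Qed.

Lemma density_le_max : P.-negligible [set w | exists x, exists F,
  has_density (K w x) F /\ max_density < F].
Proof.
have n0 : P.-negligible [set w | exists k : nat, dense_cluster (max_density + k.+1%:R^-1) w].
  apply: negligible_exists => // k.
  apply/(negligibleE P (measurable_dense_cluster _)).
  have [//|d1] := dense_cluster_01 (max_density + k.+1%:R^-1).
  have := ub_le_sup dense_set_sup.2 d1; rewrite -/max_density gerDl leNgt.
  by rewrite invr_gt0 ltr0n.
apply: (negligibleS _ n0) => w [x [F [xF MF]]].
have MF0 : 0 < F - max_density by rewrite subr_gt0.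
have [k ke] := exists_invS_lt MF0.
by exists k; apply: density_dense_cluster xF _; rewrite addrC -ltrBrDr.
Qed.

Lemma max_density_approached : P.-negligible [set w | exists k : nat,
  ~ dense_cluster (max_density - k.+1%:R^-1) w].
Proof.
apply: negligible_exists => // k.
have k0 : 0 < k.+1%:R^-1 :> R by rewrite invr_gt0.
have [q q1 qM] := sup_adherent k0 dense_set_sup.
have mq := measurable_dense_cluster q.
apply: (@negligibleS _ _ _ _ [set w | ~ dense_cluster q w]) => [w|].
  by apply: contra_not; apply: dense_cluster_le; exact: ltW.
apply/(negligibleE P (measurable_compl mq)).
by have := PrC P mq; rewrite q1 subrr.
Qed.

(** Merging the clusters of x and y by a path gives a cluster which contains both,
    and whose density is at most the maximal one. *)
Lemma disjoint_density_le : P.-negligible [set w | exists xy : Gamma * Gamma,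
  ~ linked w xy.1 xy.2 /\ exists F F', [/\ has_density (K w xy.1) F,
    has_density (K w xy.2) F' & max_density < F + F']].
Proof.
have cGG : countable [set: Gamma * Gamma].
  have := cG; rewrite !/(countable _) => cG'.
  by rewrite -setXTT; apply: countableX.
apply: negligible_exists => // -[x y] /=.
have [phi [phi0 phixy phiS]] := merge_map x y.
have n1 := phi0 _ densities_exist_ae; have n2 := phi0 _ density_le_max.
apply: (negligibleS _ (negligibleU n1 n2)) => w [nxy [F [F' [xF yF MF]]]].
have [gw|] := pselect (densities_exist (phi w)); last by left.
have [F'' xF''] := gw x; right; exists x, F''; split => //.
apply: lt_le_trans MF _.
have dis : K w x `&` K w y = set0.
  apply/seteqP; split => // z [xz yz]; apply: nxy.
  exact: linked_trans xz (linked_sym yz).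
apply: (has_density_le _ (has_density_disjoint dis xF yF) xF'').
move=> z [xz|yz]; first exact: phiS.
exact: linked_trans (phixy w) (phiS _ _ _ yz).
Qed.

(** Two clusters of positive density could be merged with a cluster of nearly
    maximal density, unless they coincide with it. *)
Lemma heavy_unique : P.-negligible [set w | ~ forall x y,
  ~ light (K w x) -> ~ light (K w y) -> linked w x y].
Proof.
apply: (negligibleS _ (negligibleU densities_exist_ae (negligibleU max_density_approached
  disjoint_density_le))) => w nw.
apply: contrapT => /not_orP[/contrapT gw] /not_orP[/= ap dis]; apply: nw => x y hx hy.
have [F xF] := gw x; have [F' yF] := gw y.
have pos z G : has_density (K w z) G -> ~ light (K w z) -> 0 < G.
  move=> zG hz; rewrite lt_neqAle (has_density_ge0 zG) andbT.
  by apply/eqP => G0; apply: hz; rewrite /light G0.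
have F0 := pos _ _ xF hx; have F0' := pos _ _ yF hy.
have m0 : 0 < Num.min F F' by rewrite lt_min F0.
have [k ke] := exists_invS_lt m0.
have [z zk] : dense_cluster (max_density - k.+1%:R^-1) w.
  by apply: contrapT => nk; apply: ap; exists k.
have [Fz zF] := gw z.
have Fz_ge : max_density - k.+1%:R^-1 <= Fz.
  have [N hN] := zk _ (subgroup1 sH).
  apply: (ler_cvg_to (cvg_cst _) (zF _ (subgroup1 sH))).
  by exists N => // n /hN.
have lz u G : has_density (K w u) G -> k.+1%:R^-1 < G -> linked w z u.
  move=> uG kG; apply: contrapT => nzu; apply: dis; exists (z, u); split => //.
  by exists Fz, G; split => //; rewrite -ltrBlDr; apply: lt_le_trans Fz_ge; rewrite ltrD2l ltrN2.
move: ke; rewrite lt_min => /andP[kF kF'].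
exact: linked_trans (linked_sym (lz _ _ xF kF)) (lz _ _ yF kF').
Qed.

Variables (delta : R) (delta_gt0 : 0 < delta).
Hypothesis tau_ge : forall x y, H x -> H y -> delta <= tau x y.

(** Choose distinct points of H. Each is connected to 1 with probability at least
    delta, so with this probability infinitely many of them are. *)
Lemma infinite_ae : P.-negligible [set w | ~ exists x, infinite_along H (K w x)].
Proof.
pose A w := exists x, infinite_along H (K w x).
have mA : measurable [set w | A w].
  apply: measurable_ex => // x; apply: measurable_infinite_along => // y.
  exact: measurable_linked.
have zo : Pr [set w | A w] = 0 \/ Pr [set w | A w] = 1.
  apply: (zero_one p_01 P_p H_inf mA).
  suff imp h w : H h -> A w -> A (translate h w).
    move=> h w Hh; split; last exact: imp.
    by move=> /(imp h^-1%g); rewrite translateK; apply; exact: subgroupV.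
  move=> Hh [x xinf]; exists (h * x)%g.
  by rewrite open_cluster_translate; apply/infinite_along_translate.
case: zo => [A0|A1]; last first.
  apply/(negligibleE P (measurable_compl mA)).
  by have := PrC P mA; rewrite A1 subrr.
have [f fP] := infinite_alongP H cG.
have /choice[h hP] n : exists h, H h /\ (n <= f h)%N.
  have : infinite_along H setT by rewrite /infinite_along setTI.
  by move=> /fP/(_ n)[h [_ Hh nh]]; exists h.
have := @Pr_io_ge _ _ _ P (fun n => [set w | linked w 1%g (h n)]) delta
  (fun n => measurable_linked cG _ _).
move=> /(_ (fun n => tau_ge (subgroup1 sH) (hP n).1)).
suff io0 : Pr [set w | forall N, exists n, (N <= n)%N /\ linked w 1%g (h n)] <= 0.
  by move=> /le_trans /(_ io0); rewrite leNgt delta_gt0.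
rewrite -A0; apply: le_Pr => //.
  apply: measurable_all => // N; apply: measurable_ex => // n.
  by apply: measurable_conj; [exact: measurable_prop|exact: measurable_linked].
move=> w io; exists 1%g; apply/fP => N; have [n [Nn ln]] := io N.
exists (h n); split => //; first exact: (hP n).1.
exact: leq_trans Nn (hP n).2.
Qed.

(** The mean mass of the cluster of 1 is at least delta for each measure [b n], so
    its density is at least half of this with positive probability. *)
Lemma heavy_ae : P.-negligible [set w | ~ exists x, ~ light (K w x)].
Proof.
have d2 : 0 < delta / 2 by rewrite divr_gt0.
have d4 : 0 < delta / 4 by rewrite divr_gt0.
have mD := measurable_dense_cluster (delta / 4).
suff D1 : Pr [set w | dense_cluster (delta / 4) w] = 1.
  apply: (@negligibleS _ _ _ _ [set w | ~ dense_cluster (delta / 4) w]) => [w|].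
    apply: contra_not => -[x dx]; exists x => /(_ _ (subgroup1 sH)) lx.
    have [N hN] := dx _ (subgroup1 sH).
    suff : delta / 4 <= 0 by rewrite leNgt d4.
    apply: (ler_cvg_to (cvg_cst _) lx).
    by exists N => // n /hN.
  apply/(negligibleE P (measurable_compl mD)).
  by have := PrC P mD; rewrite D1 subrr.
have [D0|//] := dense_cluster_01 (delta / 4).
pose F n := [set w | delta / 2 <= mass (b n) (K w 1%g)].
have mF n : measurable (F n).
  apply: (measurable_mass _ (fun t => delta / 2 <= t)) => y; exact: measurable_linked.
have Fge n : delta / 2 <= Pr (F n).
  have wb := b_weight n; have [bH b1] := wb.
  have h0 := @comb_le_Pr _ _ _ P _ (b n) fst (fun u w => linked w 1%g u.2)
    (F n) (delta / 2) (fun u => measurable_linked cG _ _) (mF n) (ltW d2).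
  have h1 : delta <= \sum_(u <- b n) u.1 * tau 1%g u.2.
    rewrite -[delta]mul1r -b1 mulr_suml big_seq [leRHS]big_seq; apply: ler_sum => u /bH[u0 Hu].
    by apply: ler_wpM2l => //; apply: tau_ge => //; exact: subgroup1.
  suff h2 : \sum_(u <- b n) u.1 * tau 1%g u.2 <= delta / 2 + Pr (F n) by lra.
  apply: h0 => w; first by case/andP: (weight_mass_bounds (K w 1%g) wb).
  by move=> /negP; rewrite -ltNge => /ltW.
have io_ge := Pr_io_ge mF Fge.
suff io0 : Pr [set w | forall N, exists n, (N <= n)%N /\ F n w] = 0.
  by move: io_ge; rewrite io0 leNgt d2.
have mio : measurable [set w | forall N, exists n, (N <= n)%N /\ F n w].
  apply: measurable_all => // N; apply: measurable_ex => // n.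
  by apply: measurable_conj; [exact: measurable_prop|exact: mF].
apply/(negligibleE P mio).
have nD : P.-negligible [set w | dense_cluster (delta / 4) w] by apply/(negligibleE P mD).
apply: (negligibleS _ (negligibleU nD densities_exist_ae)) => w io.
have [gw|] := pselect (densities_exist w); last by right.
left; have [G xG] := gw 1%g; apply: (density_dense_cluster xG).
rewrite ltNge; apply/negP => Gd.
have /cvg_epsilonP/(_ _ d4)[N hN] := xG _ (subgroup1 sH).
have [n [Nn Fn]] := io N; have := hN n Nn; rewrite mass_shift invg1.
have -> : translate_set 1%g (K w 1%g) = K w 1%g.
  by apply/seteqP; split => y; rewrite translate_setP invg1 mul1g.
by rewrite ltr_norml => /andP[_]; move: Fn Gd; rewrite /F /=; lra.
Qed.

End heavy_clusters.

(** * Light branches of a fixed configuration *)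

Section chains.
Variables (T : eqType) (le : T -> T -> Prop) (Q : T -> Prop).
Hypothesis le_trans : forall a b c, le a b -> le b c -> le a c.
Hypothesis le_total : forall a b, Q a -> Q b -> le a b \/ le b a.

Lemma seq_minimum (l : seq T) : (exists2 a, a \in l & Q a) ->
  exists a, [/\ a \in l, Q a & forall c, c \in l -> Q c -> le a c].
Proof.
elim: l => [[a]//|t l IHl] ex.
have [Qt|nQt] := pselect (Q t); last first.
  have [|a [al Qa amin]] := IHl.
    by case: ex => a; rewrite inE => /orP[/eqP ->//|al Qa]; exists a.
  exists a; split => //; first by rewrite inE al orbT.
  by move=> c; rewrite inE => /orP[/eqP ->//|]; exact: amin.
have lett : le t t by have [] := le_total Qt Qt.
have [/IHl[a [al Qa amin]]|nex] := pselect (exists2 a, a \in l & Q a); last first.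
  exists t; split => //; first by rewrite mem_head.
  move=> c; rewrite inE => /orP[/eqP ->//|cl Qc].
  by case: nex; exists c.
have [ta|at_] := le_total Qt Qa.
  exists t; split => //; first by rewrite mem_head.
  move=> c; rewrite inE => /orP[/eqP ->//|cl Qc].
  exact: le_trans ta (amin _ cl Qc).
exists a; split => //; first by rewrite inE al orbT.
by move=> c; rewrite inE => /orP[/eqP ->//|]; exact: amin.
Qed.

End chains.

Section light_branches.
Variables (Gamma : groupType) (S : set Gamma) (H : set Gamma).
Local Notation edge := (cayley_edges S).
Local Notation config := (config S).
Variables (u0 v0 : Gamma) (e0 : edge) (e0E : val e0 = [set v0; u0]).
Variable Light : set Gamma -> Prop.
Hypothesis LightS : forall A B, A `<=` B -> Light B -> Light A.
Implicit Types (w : config) (s t r x y z h : Gamma).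
Local Notation K := (@open_cluster Gamma S).

Definition sever s w : config := update (mul_edge s e0) false w.
Definition branch_of w s : set Gamma := K (sever s w) (s * u0)%g.
Definition stem_of w s : set Gamma := K (sever s w) (s * v0)%g.

(** Sites are what opening an edge between a light H-infinite cluster and a heavy
    one creates. Only one of branch and stem is light, so they are disjoint and the
    edge of a site is a bridge. *)
Definition is_site w s := [/\ H s, w (mul_edge s e0) = true,
  infinite_along H (branch_of w s), Light (branch_of w s) & ~ Light (stem_of w s)].

Section fixed_configuration.
Variable w : config.
Local Notation site := (is_site w).
Local Notation branch := (branch_of w).
Local Notation stem := (stem_of w).

Lemma site_edge s : val (mul_edge s e0) = [set (s * v0)%g; (s * u0)%g].
Proof. by rewrite val_mul_edge e0E image_setU !image_set1. Qed.

Lemma site_adj s : site s -> open_adj w (s * v0)%g (s * u0)%g.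
Proof. by move=> [_ se _ _ _]; exists (mul_edge s e0); rewrite site_edge. Qed.

Lemma branch_u s : branch s (s * u0)%g.
Proof. exact: linked_refl. Qed.

Lemma stem_v s : stem s (s * v0)%g.
Proof. exact: linked_refl. Qed.

Lemma branch_stem s z : site s -> branch s z -> stem s z -> False.
Proof.
move=> [_ _ _ lb hs] bz sz; apply: hs.
rewrite /stem_of -(open_cluster_eq (_ : linked (sever s w) (s * u0)%g (s * v0)%g))//.
exact: linked_trans bz (linked_sym sz).
Qed.

Lemma branch_v s : site s -> ~ branch s (s * v0)%g.
Proof. by move=> ss /(branch_stem ss); apply; exact: stem_v. Qed.

Lemma sever_adj s x y : open_adj w x y -> open_adj (sever s w) x y \/
  (x = s * v0 /\ y = s * u0)%g \/ (x = s * u0 /\ y = s * v0)%g.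
Proof.
move=> [e [ve we]]; have [es|es] := eqVneq e (mul_edge s e0).
  by right; apply: set2_inj; rewrite -ve es site_edge.
by left; exists e; split => //; rewrite /sever /update (negPf es).
Qed.

Lemma branch_adj s x y : site s -> branch s x -> open_adj w x y ->
  branch s y \/ (x = s * u0 /\ y = s * v0)%g.
Proof.
move=> ss bx /(sever_adj s)[xy|[[xv _]|]]; last by right.
  by left; apply: linked_trans bx (linked_adj xy).
by case: (branch_v ss); rewrite -xv.
Qed.

Lemma sever_open s x y : open_adj (sever s w) x y -> open_adj w x y.
Proof.
move=> [e [ve we]]; exists e; split => //.
by move: we; rewrite /sever /update; case: eqP.
Qed.

(** The stem end of s cannot lie in the branch of t as well: the stem of t would
    then lie in the light branch of s. This is what orients the sites. *)
Lemma branch_nested s t : site s -> site t -> branch s (t * v0)%g ->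
  branch t `<=` branch s.
Proof.
move=> ss st btv.
have [bsv|nbsv] := pselect (branch t (s * v0)%g).
  have sub : stem t `<=` branch s.
    move=> z sz; suff [] : branch s z /\ stem t z by [].
    apply: (linked_set (A := [set z | branch s z /\ stem t z]) _ _ sz); last first.
      by split => //; exact: stem_v.
    move=> a c [ba sa] ac; have sc : stem t c by exact: linked_trans sa (linked_adj ac).
    split => //; have [//|[_ cE]] := branch_adj ss ba (sever_open ac).
    by case: (branch_stem st bsv); rewrite -cE.
  by case: st => _ _ _ _ []; apply: LightS sub _; case: ss.
have bu : branch s (t * u0)%g.
  have [//|[_ uE]] := branch_adj ss btv (site_adj st).
  by case: nbsv; rewrite -uE; exact: branch_u.
move=> z bz; suff [] : branch s z /\ branch t z by [].
apply: (linked_set (A := [set z | branch s z /\ branch t z]) _ _ bz); last first.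
  by split => //; exact: branch_u.
move=> a c [ba bta] ac; have btc : branch t c by exact: linked_trans bta (linked_adj ac).
split => //; have [//|[_ cE]] := branch_adj ss ba (sever_open ac).
by case: nbsv; rewrite -cE.
Qed.

(** If the stem end of s lies outside the branch of t, this branch avoids the edge
    of s, so the branch of s contains it, and with it the stem end of t. *)
Lemma branch_meet s t z : site s -> site t -> s <> t -> branch s z -> branch t z ->
  branch s (t * v0)%g \/ branch t (s * v0)%g.
Proof.
move=> ss st nst bsz btz; apply: contrapT => /not_orP[ns nt].
have bu : branch s (t * u0)%g.
  suff [] : branch s (t * u0)%g /\ branch t (t * u0)%g by [].
  apply: (linked_set (A := [set z | branch s z /\ branch t z]) (w := sever t w)
    (x := z)) => //; last exact: linked_sym.
  move=> a c [ba bta] ac; have btc : branch t c by exact: linked_trans bta (linked_adj ac).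
  split => //; have [//|[_ cE]] := branch_adj ss ba (sever_open ac).
  by case: nt; rewrite -cE.
have [//|[_ /mulIg ts]] := branch_adj ss bu (open_adj_sym (site_adj st)).
exact: nst.
Qed.

Lemma branch_comparable z s t : site s /\ branch s z -> site t /\ branch t z ->
  branch s `<=` branch t \/ branch t `<=` branch s.
Proof.
move=> [ss bs] [st bt]; have [->|nst] := pselect (s = t); first by left.
have [h|h] := branch_meet ss st nst bs bt; [right|left]; exact: branch_nested h.
Qed.

Lemma branch_inj s t : site s -> site t -> branch s = branch t -> s = t.
Proof.
move=> ss st bE; apply: contrapT => nst.
have bu : branch t (s * u0)%g by rewrite -bE; exact: branch_u.
have [|] := branch_meet ss st nst (branch_u s) bu; last by rewrite -bE; exact: branch_v.
by rewrite bE; exact: branch_v.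
Qed.

(** To leave the branch of a site a path has to cross the edge of this site, and
    this edge determines the site. *)
Lemma finitely_separating x y : linked w x y -> exists l : seq Gamma,
  forall s, site s -> branch s x -> ~ branch s y -> s \in l.
Proof.
elim=> [a c ac|a|a c d _ [l lP] _ [l' l'P]]; last 2 first.
- by exists [::].
- exists (l ++ l') => s ss sa sd; rewrite mem_cat.
  have [sc|sc] := pselect (branch s c); last by rewrite lP.
  by rewrite l'P ?orbT.
exists [:: (a / u0)%g] => s ss sa sc; have [//|[-> _]] := branch_adj ss sa ac.
by rewrite mulgK mem_head.
Qed.

Lemma branch_linked s z : site s -> branch s z -> linked w z (s * v0)%g.
Proof.
move=> ss bz; apply: linked_trans (linked_close (linked_sym bz)) _.
exact/linked_sym/linked_adj/site_adj.
Qed.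

Definition is_first_site z s := [/\ site s, branch s z &
  forall t, site t -> branch t z -> branch s `<=` branch t].
Local Notation first_site := is_first_site.

Lemma first_site_unique z s t : first_site z s -> first_site z t -> s = t.
Proof.
move=> [ss sz smin] [st tz tmin]; apply: branch_inj => //.
by apply/seteqP; split; [exact: smin|exact: tmin].
Qed.

Lemma smallest_site z s (Q : Gamma -> Prop) : (forall t, Q t -> site t /\ branch t z) ->
  Q s -> exists r, Q r /\ forall t, Q t -> branch r `<=` branch t.
Proof.
move=> Qz Qs; have [ss sz] := Qz _ Qs.
have [l lP] := finitely_separating (branch_linked ss sz).
have [|||r [rl Qr rmin]] := @seq_minimum _ (fun s t => branch s `<=` branch t) Q _ _ l.
- by move=> a b c; exact: subset_trans.
- by move=> a b /Qz ? /Qz; exact: branch_comparable.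
- by exists s => //; apply: lP => //; exact: branch_v.
exists r; split => // t Qt; have [st tz] := Qz _ Qt.
have [tv|tv] := pselect (branch t (s * v0)%g); last by apply: rmin => //; exact: lP.
apply: (subset_trans (rmin s _ Qs)); last exact: branch_nested.
by apply: lP => //; exact: branch_v.
Qed.

Lemma largest_site z y s (Q : Gamma -> Prop) : linked w z y ->
  (forall t, Q t -> [/\ site t, branch t z & ~ branch t y]) ->
  Q s -> exists r, Q r /\ forall t, Q t -> branch t `<=` branch r.
Proof.
move=> zy Qz Qs; have [l lP] := finitely_separating zy.
have Ql t : Q t -> t \in l by move=> /Qz[st tz ty]; exact: lP.
have [|||r [rl Qr rmax]] := @seq_minimum _ (fun s t => branch t `<=` branch s) Q _ _ l.
- by move=> a b c ba cb; exact: subset_trans cb ba.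
- move=> a b /Qz[sa az _] /Qz[sb bz _].
  by have [] := branch_comparable (conj sb bz) (conj sa az); [left|right].
- by exists s => //; exact: Ql.
by exists r; split => // t Qt; apply: rmax => //; exact: Ql.
Qed.

Lemma first_site_exists z s : site s -> branch s z -> exists t, first_site z t.
Proof.
move=> ss sz.
have [||r [[sr rz] rmin]] := @smallest_site z s (fun t => site t /\ branch t z).
- by [].
- by [].
by exists r; split => // t st tz; exact: rmin.
Qed.

(** The child is the largest site around z that lies strictly inside the branch of
    s; only finitely many separate z from s. *)
Lemma child_containing z s : site s -> branch s z -> ~ first_site z s ->
  exists t, [/\ site t, branch t z & first_site (t * v0)%g s].
Proof.
move=> ss sz nfs; have [t [st tz tmin]] := first_site_exists ss sz.
have nts : t <> s by move=> ts; apply: nfs; rewrite -ts.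
have nsv r : site r -> branch r `<=` branch s -> ~ branch r (s * v0)%g.
  by move=> sr rs /rs; exact: branch_v.
pose Q r := [/\ site r, branch r z, r <> s & ~ branch r (s * v0)%g].
have [||r [[sr rz nrs rsv] rmax]] := @largest_site z _ t Q (branch_linked ss sz).
- by move=> r [].
- by split => //; apply: nsv => //; exact: tmin.
exists r; split => //.
have srv : branch s (r * v0)%g by have [] := branch_meet ss sr (nesym nrs) sz rz.
split => // q sq qrv.
have qz : branch q z by exact: (branch_nested sq sr qrv).
have [qsv|nqsv] := pselect (branch q (s * v0)%g); first exact: branch_nested.
have [->//|nqs] := pselect (q = s).
by case: (branch_v sr); apply: (rmax q).
Qed.

(** Parents lead to a branch containing both points. If the smallest such branch
    were the first one around neither of them, it would have a child around x and a
    child around y; these are the same child, which contradicts minimality. *)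
Lemma chain_comparable x y s0 :
  (forall s, site s -> exists t, first_site (s * v0)%g t) ->
  (forall s t t', site t -> site t' -> first_site (t * v0)%g s ->
    first_site (t' * v0)%g s -> t = t') ->
  first_site x s0 -> linked w x y ->
  (exists s, first_site x s /\ branch s y) \/ (exists s, first_site y s /\ branch s x).
Proof.
move=> parent one_child [ss0 s0x _] xy.
have [r0 [sr0 r0x r0y]] : exists r, [/\ site r, branch r x & branch r y].
  apply: contrapT => nr.
  have ny t : site t -> branch t x -> ~ branch t y by move=> st tx ty; apply: nr; exists t.
  have [||r [[sr rx] rmax]] := @largest_site x y s0 (fun t => site t /\ branch t x) xy.
  - by move=> t [st tx]; split => //; exact: ny.
  - by [].
  have [t [st trv _]] := parent r sr; have rt := branch_nested st sr trv.
  by case: (branch_v sr); apply: (rmax t) => //; split => //; exact: rt.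
have [||r [[sr rx ry] rmin]] :=
    @smallest_site x r0 (fun t => [/\ site t, branch t x & branch t y]).
- by move=> t [].
- by [].
have [fx|nfx] := pselect (first_site x r); first by left; exists r.
have [fy|nfy] := pselect (first_site y r); first by right; exists r.
have [t [st tx ft]] := child_containing sr rx nfx.
have [t' [st' ty ft']] := child_containing sr ry nfy.
have tt' := one_child _ _ _ st st' ft ft'; rewrite -tt' in ty.
have rt : branch r `<=` branch t by apply: rmin.
by case: (branch_v st); apply: rt; case: ft.
Qed.

End fixed_configuration.

End light_branches.

(** * The mass transport principle *)

Section mass_transport.
Variables (Gamma : groupType) (S : set Gamma) (H : set Gamma).
Variables (sH : is_subgroup H) (cG : countable [set: Gamma]).
Local Notation config := (config S).
Variables (R : realType) (p : R).
Variable P : probability config R.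
Hypothesis P_p : bernoulli_percolation p P.
Local Notation Pr := (Prob P).
Implicit Types (w : config) (x y z h s : Gamma).

Lemma enumerate_subset : exists l : nat -> seq Gamma, [/\ forall n, uniq (l n),
  forall n x, x \in l n -> H x, forall n m, (n <= m)%N -> {subset l n <= l m} &
  forall x, H x -> exists n, x \in l n].
Proof.
have /countable_injP[f finj] := cG.
have fin n : finite_set [set x | H x /\ (f x < n)%N].
  apply: (@sub_finite_set _ _ (f @^-1` `I_n)) => [x []//|].
  by apply: finite_preimage; [move=> x y _ _; apply: finj; rewrite inE|exact: finite_II].
have /choice[l lP] n : exists l : seq Gamma,
    uniq l /\ forall x, x \in l <-> H x /\ (f x < n)%N.
  have /finite_seqP[l lE] := fin n; exists (undup l); split; first exact: undup_uniq.
  by move=> x; rewrite mem_undup; have := lE; rewrite predeqE => /(_ x)[].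
exists l; split.
- by move=> n; have [] := lP n.
- by move=> n x; have [_ /(_ x)[+ _]] := lP n => /[apply] -[].
- move=> n m nm x; have [_ /(_ x)[+ _]] := lP n => /[apply] -[Hx fx].
  by have [_ /(_ x)[_]] := lP m; apply; split => //; exact: leq_trans nm.
- by move=> x Hx; exists (f x).+1; have [_ /(_ x)[_]] := lP (f x).+1; exact.
Qed.

Lemma Pr_exhaust_le (F : nat -> config -> Prop) (c : R) n0 :
  (forall n, measurable [set w | F n w]) ->
  (forall n m w, (n <= m)%N -> F n w -> F m w) ->
  (forall n, (n0 <= n)%N -> Pr [set w | F n w] <= c) ->
  Pr [set w | exists n, F n w] <= c.
Proof.
move=> mF ndF Fc; rewrite -lee_fin -PrE; last exact: measurable_ex.
have -> : [set w | exists n, F n w] = \bigcup_n [set w | F n w].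
  by apply/seteqP; split => w; [move=> [n Fn]; exists n|move=> [n _ Fn]; exists n].
have cv : (P \o (fun n => [set w | F n w])) x @[x --> \oo] --> P (\bigcup_n [set w | F n w]).
  apply: nondecreasing_cvg_mu => //; first exact: bigcupT_measurable.
  by move=> n m nm; rewrite subsetEset => w; exact: ndF.
rewrite -(cvg_lim _ cv)//; apply: lime_le; first by apply/cvg_ex; eexists; exact: cv.
by exists n0 => // n /= n0n; rewrite PrE// lee_fin Fc.
Qed.

(** [A w x s] reads: in the configuration w, the point x sends a unit mass to s. *)
Variable A : config -> Gamma -> Gamma -> Prop.
Hypothesis mA : forall x s, measurable [set w | A w x s].
Hypothesis A_translate : forall h w x s, H h ->
  A (translate h w) (h * x)%g (h * s)%g <-> A w x s.
Hypothesis A_fun : forall w x s s', A w x s -> A w x s' -> s = s'.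

Let sent w := exists s, H s /\ A w 1%g s.

Let m_sent : measurable [set w | sent w].
Proof.
by apply: measurable_ex => // s; apply: measurable_conj => //; exact: measurable_prop.
Qed.

(** By invariance, the mass that 1 receives from x has the law of the mass that 1
    sends to x^-1; and 1 sends at most one unit. *)
Lemma mass_transport (l : seq Gamma) : uniq l -> (forall x, x \in l -> H x) ->
  \sum_(x <- l) Pr [set w | A w x 1%g] <= Pr [set w | sent w].
Proof.
move=> ul lH.
have -> : \sum_(x <- l) Pr [set w | A w x 1%g] = \sum_(x <- l) 1 * Pr [set w | A w 1%g x^-1%g].
  rewrite big_seq [RHS]big_seq; apply: eq_bigr => x /lH Hx; rewrite mul1r.
  rewrite -[RHS](Pr_translate P_p x^-1%g (mA _ _)).
  congr (Pr _); apply: eq_set => w; apply/propext.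
  by rewrite -(A_translate w x 1%g (subgroupV sH Hx)) mulVg mulg1.
rewrite -[leRHS]add0r; apply: comb_le_Pr => //.
- move=> w; rewrite /comb.
  elim: l ul lH => [|x l IHl] /=; first by rewrite big_nil.
  move=> /andP[xl ul] lH; rewrite big_cons mul1r.
  have {}IHl : \sum_(i <- l) 1 * (`[< A w 1%g i^-1%g >])%:R <= 1 :> R.
    by apply: IHl => // y yl; apply: lH; rewrite inE yl orbT.
  case: asboolP => Ax; last by rewrite add0r.
  rewrite big_seq big1 ?addr0// => y yl; rewrite asboolF ?mulr0// => Ay.
  by move: xl; rewrite (invg_inj (A_fun Ax Ay)) yl.
- move=> w ns; rewrite /comb big_seq big1// => x /lH Hx; rewrite asboolF ?mulr0// => Ax.
  by apply: ns; exists x^-1%g; split => //; exact: subgroupV.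
Qed.

Let received (l : seq Gamma) w := count (fun x => `[< A w x 1%g >]) l.

Let receivedE l w : comb l (fun=> 1 : R) (fun x => A w x 1%g) = (received l w)%:R.
Proof.
rewrite /comb /received; elim: l => [|x l IHl]; first by rewrite big_nil.
by rewrite big_cons IHl /= natrD mul1r.
Qed.

Let received_sub l l' w : uniq l -> {subset l <= l'} -> (received l w <= received l' w)%N.
Proof.
move=> ul ll'; rewrite /received -!size_filter; apply: uniq_leq_size.
  exact: filter_uniq.
by move=> x; rewrite !mem_filter => /andP[-> /ll' ->].
Qed.

Let measurable_received l k : measurable [set w | (k <= received l w)%N].
Proof.
have -> : [set w | (k <= received l w)%N] =
    [set w | k%:R <= comb l (fun=> 1 : R) (fun x => A w x 1%g)].
  by apply: eq_set => w; rewrite receivedE ler_nat.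
exact: (@measurable_comb _ _ _ _ l (fun=> 1) (fun x w => A w x 1%g) (fun t => k%:R <= t)).
Qed.

(** The expected mass received is at most one. *)
Lemma mass_transport_finite :
  P.-negligible [set w | infinite_along H [set x | A w x 1%g]].
Proof.
have mI : measurable [set w | infinite_along H [set x | A w x 1%g]].
  by apply: measurable_infinite_along => // y; exact: mA.
apply/(negligibleE P mI); apply/eqP; rewrite eq_le Pr_ge0 andbT.
apply/ler_addgt0Pr => e e0; rewrite add0r.
have [k ke] := exists_invS_lt e0; apply: le_trans (ltW ke).
have [l [ul lH lS lT]] := enumerate_subset.
pose N n w := received (l n) w.
apply: (@le_trans _ _ (Pr [set w | exists n, (k.+1 <= N n w)%N])).
  apply: le_Pr => //; first by apply: measurable_ex => // n; exact: measurable_received.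
  move=> w inf; elim: {ke}k.+1 => [|j [n jn]]; first by exists 0.
  have [x [Ax Hx xl]] : exists x, [/\ A w x 1%g, H x & x \notin l n].
    apply: contrapT => nx; apply: inf; apply: (sub_finite_set _ (finite_seq (l n))) => x /=.
    by move=> [Ax Hx]; apply: contrapT => /negP xl; apply: nx; exists x.
  have [m xm] := lT x Hx; exists (maxn n m).
  have : (received (x :: l n) w <= N (maxn n m) w)%N.
    apply: received_sub; first by rewrite /= xl ul.
    move=> y; rewrite inE => /orP[/eqP ->|yl].
      exact: lS (leq_maxr _ _) _ xm.
    exact: lS (leq_maxl _ _) _ yl.
  by apply: leq_trans; rewrite /received /= asboolT// add1n ltnS.
apply: (@Pr_exhaust_le _ _ 0).
- by move=> n; exact: measurable_received.
- move=> n m w nm /leq_trans; apply; apply: received_sub => //; exact: lS.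
move=> n _; rewrite -[leRHS]mul1r ler_pdivlMr ?ltr0n// mulrC.
have := mass_transport (ul n) (lH n).
have -> : \sum_(x <- l n) Pr [set w | A w x 1%g] = \sum_(x <- l n) 1 * Pr [set w | A w x 1%g].
  by under [RHS]eq_bigr do rewrite mul1r.
move=> sum_le; apply: le_trans (le_trans sum_le (Pr_le1 P m_sent)).
apply: Pr_comb_markov => //.
- exact: measurable_received.
- by move=> w; rewrite receivedE.
- by move=> w; rewrite receivedE ler_nat.
Qed.

(** Let B be the event that 1 belongs to a random set. If the points of this set
    receive mass and only they send some, then the expected mass received is at
    least Pr B and the expected mass sent at most Pr B: all the inequalities of the
    mass transport principle are equalities. *)
Lemma mass_transport_balanced (B : config -> Prop) : measurable [set w | B w] ->
  (forall w, sent w -> B w) ->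
  P.-negligible [set w | B w /\ ~ exists x, H x /\ A w x 1%g] ->
  P.-negligible [set w | B w /\ ~ sent w] /\
  forall x x', H x -> H x' -> x <> x' ->
    P.-negligible [set w | A w x 1%g /\ A w x' 1%g].
Proof.
move=> mB sB nBU.
have [l [ul lH lS lT]] := enumerate_subset.
pose U n w := exists x, x \in l n /\ A w x 1%g.
have mU n : measurable [set w | U n w].
  by apply: measurable_ex => // x; apply: measurable_conj => //; exact: measurable_prop.
have mUT : measurable [set w | exists n, U n w] by exact: measurable_ex.
have BU : Pr [set w | B w] <= Pr [set w | exists n, U n w].
  have mN : measurable [set w | B w /\ ~ exists n, U n w].
    by apply: measurable_conj => //; exact: measurable_compl.
  have N0 : Pr [set w | B w /\ ~ exists n, U n w] = 0.
    apply/(negligibleE P mN); apply: (negligibleS _ nBU) => w [Bw nU]; split => //.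
    by move=> [x [Hx Ax]]; apply: nU; have [n xn] := lT x Hx; exists n, x.
  rewrite -[leRHS]addr0 -N0; apply: le_trans (PrU_le P mUT mN); apply: le_Pr => //.
    exact: measurableU.
  move=> w Bw; have [Uw|nUw] := pselect (exists n, U n w); first by left.
  by right.
have bound (Z : config -> Prop) n0 : measurable [set w | Z w] ->
    (forall n w, (n0 <= n)%N -> Z w -> (2 <= received (l n) w)%N) ->
    Pr [set w | B w] + Pr [set w | Z w] <= Pr [set w | sent w].
  move=> mZ ZN; rewrite -lerBrDr; apply: le_trans BU _; apply: (@Pr_exhaust_le _ _ n0) => //.
    by move=> i j w ij [y [yi Ay]]; exists y; split => //; exact: lS yi.
  move=> n nn0; rewrite lerBrDr; apply: le_trans (mass_transport (ul n) (lH n)).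
  pose A' (o : option (option Gamma)) w :=
    if o is Some o' then if o' is Some y then A w y 1%g else U n w else Z w.
  pose r' (o : option (option Gamma)) : R := if o is Some (Some y) then 1 else - 1.
  have mA' o : measurable [set w | A' o w] by case: o => [[y|]|] /=.
  have := @Pr_comb_ge0 _ _ _ P _ (None :: Some None :: map (Some \o Some) (l n)) r' A' mA'.
  rewrite !big_cons big_map /= !mulN1r.
  under [X in _ + (_ + X)]eq_bigr do rewrite mul1r.
  move=> h; suff {h} /h : forall w, 0 <= \sum_(i <- None :: Some None :: map (Some \o Some) (l n))
      r' i * (`[< A' i w >])%:R by lra.
  move=> w; rewrite !big_cons big_map.
  change (0 <= -1 * (`[< Z w >])%:R + (-1 * (`[< U n w >])%:R +
    comb (l n) (fun=> 1 : R) (fun x => A w x 1%g))).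
  rewrite receivedE.
  case: asboolP => Zw.
    have : (2%:R <= (received (l n) w)%:R :> R) by rewrite ler_nat ZN.
    by case: asboolP => _; rewrite ?mulr1n ?mulr0n => h; lra.
  case: asboolP => [[x [xl Ax]]|_]; last by rewrite !mulr0 !add0r.
  have : (1%:R <= (received (l n) w)%:R :> R).
    by rewrite ler_nat -has_count; apply/hasP; exists x => //; exact/asboolP.
  by rewrite ?mulr1n ?mulr0n => h; lra.
split; last first.
  move=> x x' Hx Hx' xx'; have mZ : measurable [set w | A w x 1%g /\ A w x' 1%g].
    exact: measurable_conj.
  apply/(negligibleE P mZ); have [n xn] := lT x Hx; have [n' xn'] := lT x' Hx'.
  have := bound _ (maxn n n') mZ.
  have : Pr [set w | sent w] <= Pr [set w | B w] by exact: le_Pr.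
  have := Pr_ge0 P [set w | A w x 1%g /\ A w x' 1%g].
  move=> h1 h2 h3; apply/eqP; rewrite eq_le h1 andbT.
  suff h : forall m w, (maxn n n' <= m)%N -> A w x 1%g /\ A w x' 1%g ->
    (2 <= received (l m) w)%N by move: h2 (h3 h); lra.
  move=> m w; rewrite geq_max => /andP[nm n'm] [Ax Ax'].
  have : (received [:: x; x'] w <= received (l m) w)%N.
    apply: received_sub; first by rewrite /= inE andbT; apply/eqP.
    by move=> y; rewrite !inE => /orP[/eqP ->|/eqP ->]; [exact: lS xn|exact: lS xn'].
  by rewrite /received /= !asboolT.
have mF : measurable [set w : config | False] by exact: measurable_prop.
have := bound (fun=> False) 0 mF (fun _ _ _ (f : False) => match f with end).
have -> : [set w : config | False] = set0 by apply/seteqP; split.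
rewrite Pr_set0 addr0 => BS.
have mN : measurable [set w | B w /\ ~ sent w].
  by apply: measurable_conj => //; exact: measurable_compl.
apply/(negligibleE P mN); have := Pr_split P mB m_sent.
have -> : [set w | B w] `&` [set w | sent w] = [set w | sent w].
  by apply: setIidr => w; exact: sB.
have := Pr_ge0 P [set w | B w /\ ~ sent w].
change [set w | B w /\ ~ sent w] with ([set w | B w] `&` ~` [set w | sent w]).
by move: BS => h1 h2 h3; apply/eqP; rewrite eq_le h2 andbT; lra.
Qed.

End mass_transport.

(** * Chains of sites *)

Section sites.
Variables (Gamma : groupType) (S : set Gamma) (H : set Gamma).
Variables (sH : is_subgroup H) (cG : countable [set: Gamma]).
Local Notation edge := (cayley_edges S).
Local Notation config := (config S).
Variables (R : realType) (p : R) (p_01 : 0 <= p <= 1).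
Variable P : probability config R.
Hypothesis P_p : bernoulli_percolation p P.
Local Notation Pr := (Prob P).
Local Notation K := (@open_cluster Gamma S).
Implicit Types (w : config) (s t x y z h : Gamma).
Variables (b : nat -> seq (R * Gamma)) (b_min : minimizing H P b).
Variables (u0 v0 : Gamma) (e0 : edge) (e0E : val e0 = [set v0; u0]).
Local Notation light := (light H b).
Local Notation branch := (branch_of u0 e0).
Local Notation stem := (stem_of v0 e0).
Local Notation site := (is_site H u0 v0 e0 light).
Local Notation first_site := (is_first_site H u0 v0 e0 light).

Let light_sub A B : A `<=` B -> light B -> light A.
Proof. exact: (lightS sH b_min). Qed.

Lemma sever_translate h w s : sever e0 (h * s)%g (translate h w) = translate h (sever e0 s w).
Proof. by rewrite /sever translate_update mul_edgeA. Qed.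

Lemma branch_translate h w s :
  branch (translate h w) (h * s)%g = translate_set h (branch w s).
Proof. by rewrite /branch_of sever_translate -mulgA open_cluster_translate. Qed.

Lemma stem_translate h w s :
  stem (translate h w) (h * s)%g = translate_set h (stem w s).
Proof. by rewrite /stem_of sever_translate -mulgA open_cluster_translate. Qed.

Lemma branch_translateP h w s x :
  branch (translate h w) (h * s)%g (h * x)%g <-> branch w s x.
Proof. by rewrite branch_translate translate_setP mulKg. Qed.

Lemma site_translate h w s : H h -> site (translate h w) (h * s)%g <-> site w s.
Proof.
move=> Hh; rewrite /is_site branch_translate stem_translate.
rewrite {1}/translate mul_edgeA mulKg.
have e1 := infinite_along_translate sH (branch w s) Hh.
have e2 := light_translate sH b (branch w s) Hh.
have e3 := light_translate sH b (stem w s) Hh.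
have e4 := subgroup_mulE sH s Hh.
by split => -[? ? ? ? ?]; split; intuition.
Qed.

Lemma first_site_translate h w x s : H h ->
  first_site (translate h w) (h * x)%g (h * s)%g <-> first_site w x s.
Proof.
suff imp g w' y t : H g -> first_site w' y t ->
    first_site (translate g w') (g * y)%g (g * t)%g.
  move=> Hh; split; last exact: imp.
  by move=> /(imp _ _ _ _ (subgroupV sH Hh)); rewrite translateK !mulKg.
move=> Hg [st ty tmin]; split; [exact/site_translate|exact/branch_translateP|].
move=> r; rewrite -[r](mulVKg g) => /(site_translate _ _ Hg) sr /branch_translateP ry.
rewrite !branch_translate => z; rewrite !translate_setP; exact: tmin.
Qed.

Lemma measurable_sever (L : config -> Prop) s : measurable [set w | L w] ->
  measurable [set w | L (sever e0 s w)].
Proof. by apply: measurable_pre; exact: measurable_update. Qed.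

Lemma measurable_branch s x : measurable [set w | branch w s x].
Proof. by apply: (@measurable_sever (fun w => K w (s * u0)%g x)); exact: measurable_linked. Qed.

Lemma measurable_stem s x : measurable [set w | stem w s x].
Proof. by apply: (@measurable_sever (fun w => K w (s * v0)%g x)); exact: measurable_linked. Qed.

Lemma measurable_site s : measurable [set w | site w s].
Proof.
have -> : [set w | site w s] = [set w | H s /\ (w (mul_edge s e0) = true /\
  (infinite_along H (branch w s) /\ (light (branch w s) /\ ~ light (stem w s))))].
  by apply: eq_set => w; apply/propext; split; [move=> []|move=> [? [? [? []]]]].
apply: measurable_conj; first exact: measurable_prop.
apply: measurable_conj; first exact: measurable_edge.
apply: measurable_conj.
  by apply: measurable_infinite_along => // y; exact: measurable_branch.
apply: measurable_conj; last apply: measurable_compl.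
  by apply: measurable_light => // y; exact: measurable_branch.
by apply: measurable_light => // y; exact: measurable_stem.
Qed.

Lemma measurable_first_site x s : measurable [set w | first_site w x s].
Proof.
have -> : [set w | first_site w x s] = [set w | site w s /\ (branch w s x /\
  forall t, site w t -> branch w t x -> forall z, branch w s z -> branch w t z)].
  by apply: eq_set => w; apply/propext; split; [move=> []|move=> [? []]].
apply: measurable_conj; first exact: measurable_site.
apply: measurable_conj; first exact: measurable_branch.
apply: measurable_all => // t; apply: measurable_imply; first exact: measurable_site.
apply: measurable_imply; first exact: measurable_branch.
apply: measurable_all => // z; apply: measurable_imply; exact: measurable_branch.
Qed.

(** Almost surely only finitely many points of H have 1 as their first site, so the
    infinite branch of a site contains points with another first site. *)
Lemma site_has_child : P.-negligible [set w | site w 1%g /\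
  ~ exists t, H t /\ (site w t /\ first_site w (t * v0)%g 1%g)].
Proof.
have := @mass_transport_finite _ _ _ sH cG _ _ _ P_p (fun w x s => first_site w x s)
  measurable_first_site first_site_translate (fun w x s s' => @first_site_unique _ _ H _ _ _ e0E light w x s s').
apply: negligibleS => w [s1 nchild]; case: (s1) => _ _ inf _ _.
apply: infinite_alongS inf => z bz; apply: contrapT => nfz; apply: nchild.
have [t [st _ ft]] := child_containing e0E light_sub s1 bz nfz.
by exists t; split => //; case: st.
Qed.

Let child w t s := site w t /\ first_site w (t * v0)%g s.

Let child_translate h w t s : H h ->
  child (translate h w) (h * t)%g (h * s)%g <-> child w t s.
Proof.
move=> Hh; rewrite /child -mulgA; have := site_translate w t Hh.
by have := first_site_translate w (t * v0)%g s Hh; intuition.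
Qed.

Let measurable_child t s : measurable [set w | child w t s].
Proof.
by apply: measurable_conj; [exact: measurable_site|exact: measurable_first_site].
Qed.

(** Let each site send mass to its parent. It has at most one parent and, by the
    previous lemma, at least one child, so mass transport gives exactly one of
    each. *)
Lemma sites_form_chains : P.-negligible [set w | ~
  ((forall s, site w s -> exists t, first_site w (s * v0)%g t) /\
   (forall s t t', site w t -> site w t' -> first_site w (t * v0)%g s ->
     first_site w (t' * v0)%g s -> t = t'))].
Proof.
have [||n1 n2] := @mass_transport_balanced _ _ _ sH cG _ _ _ P_p child
  measurable_child child_translate _ (fun w => site w 1%g) (measurable_site 1%g) _ site_has_child.
- by move=> w x s s' [_ f1] [_]; exact: (first_site_unique e0E f1).
- by move=> w [s [_ []]].
have n1' : P.-negligible [set w | exists s, site w s /\ ~ exists t, first_site w (s * v0)%g t].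
  apply: negligible_exists => // s; have [Hs|nHs] := pselect (H s); last first.
    by apply: (negligibleS _ (negligible_set0 P)) => w [[]].
  apply: (negligibleS _ (negligible_translate P_p s^-1%g n1)) => w [ss np].
  have Hs' := subgroupV sH Hs.
  split; first by rewrite -(mulVg s); apply/site_translate.
  move=> [t [_ [_ ft]]]; rewrite mul1g in ft; apply: np; exists (s * t)%g.
  by apply/(first_site_translate _ _ _ Hs'); rewrite !mulKg.
have n2' : P.-negligible [set w | exists s t t', [/\ H s, t <> t', child w t s & child w t' s]].
  apply: negligible_exists => // s; have [Hs|nHs] := pselect (H s); last first.
    by apply: (negligibleS _ (negligible_set0 P)) => w [t [t' []]].
  have Hs' := subgroupV sH Hs.
  apply: negligible_exists => // t; apply: negligible_exists => // t'.
  have [tt'|tt'] := pselect (t <> t'); last first.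
    by apply: (negligibleS _ (negligible_set0 P)) => w [].
  have [Ht|nHt] := pselect (H t /\ H t'); last first.
    by apply: (negligibleS _ (negligible_set0 P)) => w [_ _ [[Ht _ _ _ _] _] [[Ht' _ _ _ _] _]]; apply: nHt.
  have ntt' : (s^-1 * t)%g <> (s^-1 * t')%g by move=> /mulgI.
  have := n2 _ _ (subgroupM sH Hs' Ht.1) (subgroupM sH Hs' Ht.2) ntt'.
  move=> /(negligible_translate P_p s^-1%g); apply: negligibleS => w [_ _ ct ct'].
  by rewrite -(mulVg s); split; exact/child_translate.
apply: (negligibleS _ (negligibleU n1' n2')) => w nch.
apply: contrapT => /not_orP[/= c1 c2]; apply: nch; split.
  by move=> s ss; apply: contrapT => np; apply: c1; exists s.
move=> s t t' st st' ft ft'; apply: contrapT => tt'; apply: c2.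
by exists s, t, t'; split => //; case: ft => -[].
Qed.

(** When sites form chains, [below w] is a total preorder on the points of a cluster
    that lie in some branch, and its initial segments are light. *)
Let below w y x := exists s, first_site w x s /\ branch w s y.
Let covered w := exists s, first_site w 1%g s.

Let measurable_below y x : measurable [set w | below w y x].
Proof.
apply: measurable_ex => // s; apply: measurable_conj; first exact: measurable_first_site.
exact: measurable_branch.
Qed.

Let measurable_covered : measurable [set w | covered w].
Proof. by apply: measurable_ex => // s; exact: measurable_first_site. Qed.

Let below_translate h w y x : H h ->
  below (translate h w) (h * y)%g (h * x)%g <-> below w y x.
Proof.
suff imp g w' a c : H g -> below w' a c -> below (translate g w') (g * a)%g (g * c)%g.
  move=> Hh; split; last exact: imp.
  by move=> /(imp _ _ _ _ (subgroupV sH Hh)); rewrite translateK !mulKg.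
move=> Hg [s [fs bs]]; exists (g * s)%g; split; first exact/first_site_translate.
exact/branch_translateP.
Qed.

Let sum_below n : \sum_(z <- b n) z.1 * Prob P [set w | below w 1%g z.2] =
  \sum_(z <- b n) z.1 * Prob P [set w | below w z.2 1%g].
Proof.
have [[bH _] bsym _] := b_min n.
rewrite -(bsym (fun y => Prob P [set w | below w y 1%g])).
rewrite big_seq [RHS]big_seq; apply: eq_bigr => z /bH[_ Hz]; congr (_ * _).
rewrite -[RHS](Pr_translate P_p z.2^-1%g); last exact: measurable_below.
congr (Prob P _); apply: eq_set => w; apply/propext.
by rewrite -(below_translate w 1%g z.2 (subgroupV sH Hz)) mulVg mulg1.
Qed.

(** The points below 1 form a light branch, so [b n] gives them a small mean mass.
    By symmetry of [b n] and invariance of P the same holds for the points that 1 is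
    below of. On a chain there are no others in the cluster of 1, which contains a
    stem and so has positive density. *)
Lemma covered_negligible : P.-negligible [set w | covered w].
Proof.
have H1 := subgroup1 sH.
have shift1 n : shift_list 1%g (b n) = b n.
  rewrite /shift_list -[RHS]map_id; apply: eq_map => -[r x] /=; by rewrite mul1g.
pose G k w := covered w /\ forall n, (k <= n)%N -> k.+1%:R^-1 <= mass (b n) (K w 1%g).
have mG k : measurable [set w | G k w].
  apply: measurable_conj; first exact: measurable_covered.
  apply: measurable_all => // n; apply: measurable_imply; first exact: measurable_prop.
  apply: (measurable_mass _ (fun r => k.+1%:R^-1 <= r)) => y; exact: measurable_linked.
suff nG k : P.-negligible [set w | G k w].
  have nGT := negligible_exists (@countableP _ [set: nat]) nG.
  apply: (negligibleS _ (negligibleU nGT (densities_exist_ae sH cG p_01 P_p b_min))) => w [s [ss s1 smin]].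
  have [gw|] := pselect (densities_exist H b w); last by right.
  left; have [F Fd] := gw 1%g.
  have F0 : 0 < F.
    rewrite lt_neqAle (has_density_ge0 sH b_min Fd) andbT; apply/eqP => F0.
    case: (ss) => _ _ _ _; apply; apply: (light_sub (B := K w 1%g)); last by rewrite /light F0.
    move=> z sz; apply: linked_trans (branch_linked e0E ss s1) _.
    exact: linked_close sz.
  have F2 : 0 < F / 2 by rewrite divr_gt0.
  have [k kF] := exists_invS_lt F2.
  have /cvg_epsilonP/(_ _ F2)[N hN] := Fd 1%g H1.
  exists (maxn k N); split; first by exists s.
  move=> n; rewrite geq_max => /andP[_ /hN]; rewrite shift1 ltr_norml => /andP[h _].
  apply: (@le_trans _ _ k.+1%:R^-1); last by apply: (le_trans (ltW kF)); lra.
  by rewrite lef_pV2 ?posrE ?ltr0n// ler_nat ltnS leq_maxl.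
apply: contrapT => /(Pr_gt0E (mG k)) g0.
pose eps := k.+1%:R^-1 * Prob P [set w | G k w] / 2.
have eps0 : 0 < eps by rewrite /eps divr_gt0// mulr_gt0// invr_gt0.
have [N [mN N0 chainN]] := sites_form_chains.
have sum_ge n : (k <= n)%N -> eps <= \sum_(z <- b n) z.1 * Prob P [set w | below w z.2 1%g].
  move=> kn; have [wb _ _] := b_min n; have [bH b1] := wb.
  pose A (z : R * Gamma) w := covered w /\ linked w 1%g z.2.
  have mA (u : R * Gamma) : measurable [set w | A u w].
    by apply: measurable_conj; [exact: measurable_covered|exact: measurable_linked].
  have combE w : covered w -> comb (b n) fst (A^~ w) = mass (b n) (K w 1%g).
    move=> cw; apply: eq_bigr => z _; congr (_ * (nat_of_bool _)%:R).
    by apply: asbool_equiv_eq; split => [[]|].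
  have comb0 w : ~ covered w -> comb (b n) fst (A^~ w) = 0.
    by move=> ncw; apply: big1 => z _; rewrite asboolF ?mulr0// => -[].
  have lower : k.+1%:R^-1 * Prob P [set w | G k w] <=
      \sum_(z <- b n) z.1 * Prob P [set w | A z w].
    apply: Pr_comb_markov => // [w|w [cw Gw]]; last by rewrite combE// Gw.
    have [cw|ncw] := pselect (covered w); last by rewrite comb0.
    by rewrite combE//; case/andP: (weight_mass_bounds (K w 1%g) wb).
  have upper : \sum_(z <- b n) z.1 * Prob P [set w | A z w] <=
      \sum_(z <- b n) z.1 * Prob P [set w | below w z.2 1%g] +
      \sum_(z <- b n) z.1 * Prob P [set w | below w 1%g z.2].
    rewrite -big_split /= big_seq [leRHS]big_seq; apply: ler_sum => z /bH[z0 _].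
    rewrite -mulrDr; apply: ler_wpM2l => //.
    have m1 := measurable_below z.2 1%g; have m2 := measurable_below 1%g z.2.
    have PN : Prob P N = 0 by rewrite /Prob N0.
    have := PrU_le P (measurableU _ _ m1 m2) mN; rewrite PN addr0 => h1.
    apply: le_trans (PrU_le P m1 m2); apply: le_trans h1; apply: le_Pr => //.
      by apply: measurableU => //; exact: measurableU.
    move=> w [[s fs] wz].
    have [[parent one_child]|nch] := pselect ((forall s, site w s -> exists t, first_site w (s * v0)%g t) /\
      (forall s t t', site w t -> site w t' -> first_site w (t * v0)%g s ->
       first_site w (t' * v0)%g s -> t = t')); last by right; exact: chainN.
    by left; have [|] := chain_comparable e0E light_sub parent one_child fs wz; [left|right].
  move: upper; rewrite sum_below => upper.
  (* the two sums are equal, whence the factor 2 in eps *)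
  rewrite /eps ler_pdivrMr// mulrDr mulr1; exact: le_trans lower upper.
pose D n := [set w | eps / 2 <= mass (b n) [set y | below w y 1%g]].
have mD n : measurable (D n).
  by apply: (measurable_mass _ (fun r => eps / 2 <= r)) => y; exact: measurable_below.
have D_ge n : eps / 2 <= Prob P (D (n + k)%N).
  have [wb _ _] := b_min (n + k)%N.
  have e2 : 0 <= eps / 2 by rewrite ltW// divr_gt0.
  have h0 := @comb_le_Pr _ _ _ P _ (b (n + k)%N) fst (fun u w => below w u.2 1%g)
    (D (n + k)%N) (eps / 2) (fun u => measurable_below _ _) (mD _) e2.
  suff : \sum_(z <- b (n + k)%N) z.1 * Prob P [set w | below w z.2 1%g] <=
      eps / 2 + Prob P (D (n + k)%N) by have := sum_ge (n + k)%N (leq_addl _ _); lra.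
  apply: h0 => w; first by case/andP: (weight_mass_bounds [set y | below w y 1%g] wb).
  by move=> /negP; rewrite -ltNge => /ltW.
have := Pr_io_ge (fun n => mD (n + k)%N) D_ge.
suff -> : [set w | forall M, exists n, (M <= n)%N /\ D (n + k)%N w] = set0.
  by rewrite Pr_set0 leNgt divr_gt0.
apply/seteqP; split => // w io.
have e2 : 0 < eps / 2 by rewrite divr_gt0.
have lb : light [set y | below w y 1%g].
  have [[s fs]|nc] := pselect (covered w).
    have [[_ _ _ lb _] _ _] := fs; apply: light_sub lb => y [t [ft bt]].
    by rewrite (first_site_unique e0E fs ft).
  move=> h Hh; have -> : [set y | below w y 1%g] = set0.
    by apply/seteqP; split => // y [t [ft _]]; apply: nc; exists t.
  have -> : (fun n => mass (shift_list h (b n)) set0) = fun=> 0.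
    by apply/funext => n; rewrite /mass /comb big1// => z _; rewrite asboolF ?mulr0.
  exact: cvg_cst.
have /cvg_epsilonP/(_ _ e2)[M hM] := lb 1%g H1.
have [n [Mn Dn]] := io M; have := hM (n + k)%N (leq_trans Mn (leq_addr _ _)).
by rewrite shift1 subr0 => /ltr_normlW; rewrite ltNge Dn.
Qed.

Lemma site_negligible : P.-negligible [set w | site w 1%g].
Proof.
have n1 : P.-negligible [set w | exists x, covered (translate x w)].
  apply: negligible_exists => // x.
  exact: (negligible_translate P_p x covered_negligible).
apply: (negligibleS _ n1) => w s1; case: (s1) => _ _ inf _ _.
have [f fP] := infinite_alongP H cG.
have [x [bx Hx _]] := (fP _).1 inf 0.
have [t ft] := first_site_exists e0E light_sub s1 bx.
exists x^-1%g, (x^-1 * t)%g; rewrite -(mulVg x).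
by apply/first_site_translate => //; exact: subgroupV.
Qed.

(** Opening e0 turns the cluster of u0 into the branch of a site. *)
Lemma light_heavy_adjacent_negligible : 0 < p ->
  P.-negligible [set w | [/\ infinite_along H (K w u0), light (K w u0) & ~ light (K w v0)]].
Proof.
move=> p0; apply: (negligibleS _ (negligible_update p_01 P_p e0 p0 site_negligible)).
move=> w [inf lu hv].
have closed : w e0 = false.
  case we : (w e0) => //; exfalso; apply: hv.
  suff -> : K w v0 = K w u0 by [].
  by apply: open_cluster_eq; apply: linked_adj; exists e0.
have E : sever e0 1%g (update e0 true w) = w.
  by rewrite /sever mul_edge1 update_update update_id.
split; rewrite /branch_of /stem_of ?E ?mul1g ?mul_edge1 ?updateE//.
exact: subgroup1.
Qed.

End sites.

(** * Uniqueness *)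

Section no_light_infinite_cluster.
Variables (Gamma : groupType) (S : set Gamma) (H : set Gamma).
Variables (sH : is_subgroup H) (cG : countable [set: Gamma]) (gS : generates S).
Local Notation config := (config S).
Variables (R : realType) (p : R) (p_01 : 0 <= p <= 1) (p_gt0 : 0 < p).
Variable P : probability config R.
Hypothesis P_p : bernoulli_percolation p P.
Local Notation K := (@open_cluster Gamma S).
Variables (b : nat -> seq (R * Gamma)) (b_min : minimizing H P b).
Local Notation light := (light H b).

Lemma open_cluster_update (w : config) (e : cayley_edges S) a c : val e = [set a; c] ->
  K (update e true w) a `<=` K w a `|` K w c.
Proof.
move=> ve z; apply: (linked_set (A := K w a `|` K w c)); last by left; exact: linked_refl.
move=> x y xA [f [vf wf]]; have [fe|fe] := eqVneq f e.
  have [[_ ->]|[_ ->]] : x = a /\ y = c \/ x = c /\ y = a.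
  - by apply: set2_inj; rewrite -vf fe.
  - by right; exact: linked_refl.
  - by left; exact: linked_refl.
have xy : open_adj w x y by exists f; move: wf; rewrite /update (negPf fe).
by case: xA => xA; [left|right]; apply: linked_trans xA (linked_adj xy).
Qed.

(** Along a path from a light H-infinite cluster to a heavy cluster, either the next
    vertex is already in a heavy cluster, or opening the next edge moves the light
    H-infinite cluster one step closer. *)
Lemma light_infinite_heavy_negligible x y : P.-negligible [set w |
  [/\ infinite_along H (K w x), light (K w x) & ~ light (K w y)]].
Proof.
pattern x; apply: (@cayley_ind _ S _ y gS).
  by apply: (negligibleS _ (negligible_set0 P)) => w [].
move=> a c ac na; have [e ve] := mk_edge ac.
have n1 := light_heavy_adjacent_negligible sH cG p_01 P_p b_min ve p_gt0.
have n2 := negligible_update p_01 P_p e p_gt0 na.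
apply: (negligibleS _ (negligibleU n1 n2)) => w [cinf cl yh].
have [al|ah] := pselect (light (K w a)); last by left.
right; split.
- apply: infinite_alongS cinf => z cz.
  apply: linked_trans (linked_adj _) (linked_open e cz).
  by exists e; rewrite updateE.
- have := lightU sH b_min al cl; apply: (lightS sH b_min).
  exact: open_cluster_update.
- by apply: contra_not yh; apply: (lightS sH b_min) => z; exact: linked_open.
Qed.

End no_light_infinite_cluster.

Section uniqueness.
Variables (Gamma : groupType) (S : set Gamma) (H : set Gamma).
Variables (sH : is_subgroup H) (cG : countable [set: Gamma]) (gS : generates S).
Variable H_inf : infinite_set H.
Local Notation config := (config S).
Variables (R : realType) (p : R) (p_01 : 0 <= p <= 1).
Variable P : probability config R.
Hypothesis P_p : bernoulli_percolation p P.
Variables (delta : R) (delta_gt0 : 0 < delta).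
Hypothesis tau_ge : forall x y, H x -> H y -> delta <= tau P x y.

Lemma unique_infinite_cluster : {ae P, forall w : config,
  exists! K : set Gamma, open_clusters w K /\ infinite_along H K}.
Proof.
have p0 : 0 < p.
  rewrite lt_neqAle; case/andP: p_01 => -> _; rewrite andbT; apply/eqP => p0.
  have [y [Hy y1]] : exists y, H y /\ 1%g <> y.
    apply: contrapT => ny; apply: H_inf; apply: (sub_finite_set _ (finite_set1 1%g)) => y Hy /=.
    by apply: contrapT => y1; apply: ny; exists y; split => //; exact/nesym.
  have := tau_ge (subgroup1 sH) Hy; rewrite (tau_p0 cG p_01 P_p (esym p0) y1).
  by rewrite leNgt delta_gt0.
have [b b_min] := exists_minimizing sH cG P_p.
have light_inf x : P.-negligible [set w : config | infinite_along H (open_cluster w x) /\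
    light H b (open_cluster w x)].
  have n1 : P.-negligible [set w : config | exists y, [/\ infinite_along H (open_cluster w x),
      light H b (open_cluster w x) & ~ light H b (open_cluster w y)]].
    apply: negligible_exists => // y.
    exact: (light_infinite_heavy_negligible sH cG gS p_01 p0 P_p b_min).
  have n2 := heavy_ae sH cG p_01 P_p b_min H_inf delta_gt0 tau_ge.
  apply: (negligibleS _ (negligibleU n1 n2)) => w [xinf xl].
  have [[y yh]|nh] := pselect (exists y, ~ light H b (open_cluster w y)); last by right.
  by left; exists y.
have n1 := negligible_exists cG light_inf.
have n2 := heavy_unique sH cG gS p_01 p0 P_p b_min H_inf.
have n3 := infinite_ae sH cG p_01 P_p H_inf delta_gt0 tau_ge.
apply: (negligibleS _ (negligibleU n1 (negligibleU n2 n3))) => w nuniq.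
apply: contrapT => /not_orP[/= nl] /not_orP[/contrapT hu /contrapT[x xinf]]; apply: nuniq.
have heavy z : infinite_along H (open_cluster w z) -> ~ light H b (open_cluster w z).
  by move=> zinf zl; apply: nl; exists z.
exists (open_cluster w x); split; first by split => //; exists x.
move=> _ [[z _ <-] zinf]; apply: open_cluster_eq.
by apply: hu; exact: heavy.
Qed.

End uniqueness.

Theorem theorem1p4 (R : realType) (Gamma : groupType)
    (S : set Gamma) (S_finite : finite_set S) (S_generates : generates S)
    (H : set Gamma) (H_subgroup : is_subgroup H) (H_infinite : infinite_set H)
    (p : R) (p_01 : 0 <= p <= 1)
    (P : probability (config S) R) (P_p : bernoulli_percolation p P) :
  {ae P, forall w : config S,
     exists! K : set Gamma, open_clusters w K /\ infinite_along H K}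
  <->
  (0 < ereal_inf [set two_point P x y | x in H & y in H])%E.
Proof.
have cG := countable_generated S_finite S_generates.
split => [ae_unique|inf_gt0].
  have [c c0 tau_c] := unique_two_point_bound H_subgroup cG p_01 P_p S_generates H_infinite ae_unique.
  apply: (@lt_le_trans _ _ c%:E); first by rewrite lte_fin.
  apply/ereal_infP => _ [x Hx [y Hy <-]].
  rewrite two_pointE// lee_fin -(tau_mul cG P_p x^-1%g) mulVg.
  by apply: tau_c; apply: subgroupM => //; exact: subgroupV.
set m := ereal_inf _ in inf_gt0.
have m_le x y : H x -> H y -> (m <= (tau P x y)%:E)%E.
  by move=> Hx Hy; apply: ereal_inf_lbound; exists x => //; exists y => //; rewrite two_pointE.
have H1 := subgroup1 H_subgroup.
have mE : m = (fine m)%:E.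
  have m_lt : (m < +oo)%E by apply: le_lt_trans (m_le _ _ H1 H1) (ltry _).
  by rewrite fineK// fin_numE gt_eqF ?lt_eqF//; exact: lt_trans inf_gt0.
apply: (unique_infinite_cluster H_subgroup cG S_generates H_infinite p_01 P_p
  (delta := fine m)).
  by rewrite -lte_fin -mE.
by move=> x y Hx Hy; rewrite -lee_fin -mE; exact: m_le.
Qed.
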